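(* Let $P$ be the potential of first kind of the family of weighted arrangements $(\mathcal{C}(x),a)$, $x\in\mathbb{C}^n-\Delta$. For any two ordered independent subsets $I=\{i_1,\dots,i_k\}$, $L=\{l_1,\dots,l_k\}$ of $J$, we have $$S^{(a)}(v_{i_1,\dots,i_k},v_{l_1,\dots,l_k})=d_{i_1,\dots,i_k}\,d_{l_1,\dots,l_k}\,\frac{\partial^{2k}P}{\partial z_{i_1}\cdots\partial z_{i_k}\,\partial z_{l_1}\cdots\partial z_{l_k}}.$$
   Context: **Family of arrangements.** Let $k<n$ be positive integers, $J=\{1,\dots,n\}$. Fix nonzero linear functions $g_j=b_j^1t_1+\dots+b_j^kt_k$, $j\in J$, on $\mathbb{C}^k$, spanning $(\mathbb{C}^k)^*$. For $x\in\mathbb{C}^n$ let $\mathcal{C}(x)$ be the arrangement in $\mathbb{C}^k$ of the hyperplanes $H_j(x)=\{g_j+x_j=0\}$, $j\in J$. It is with normal crossings if exactly $k$ hyperplanes meet at every vertex (a point that is an intersection of hyperplanes). $\Delta\subset\mathbb{C}^n$ is the set of $x$ for which $\mathcal{C}(x)$ is not with normal crossings; $z_1,\dots,z_n$ are coordinates on $\mathbb{C}^n$. A subset $I\subset J$ is independent if $\{g_i\}_{i\in I}$ are linearly independent. Put $d_{i_1,\dots,i_k}=\det(b^i_{i_l})_{i,l=1}^k$. **Weights.** Fix $a=(a_1,\dots,a_n)\in(\mathbb{C}^\times)^n$; $a_J=\sum_{j\in J}a_j$. In $\mathbb{P}^k\supset\mathbb{C}^k$ the hyperplane at infinity $H_\infty$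 gets weight $-a_J$. An edge is a nonempty intersection of hyperplanes; its weight is the sum of weights of all hyperplanes containing it; it is dense if the subarrangement of hyperplanes containing it is irreducible (cannot be partitioned into nonempty sets so that, after a change of coordinates, hyperplanes in different sets are in different coordinates). $(\mathcal{C}(x),a)$ is unbalanced if every dense edge of $(H_j(x))_{j\in J}\cup\{H_\infty\}$ has nonzero weight. It is assumed that $(\mathcal{C}(x),a)$ is unbalanced for all $x\in\mathbb{C}^n-\Delta$. **Flag space.** $V=\mathcal{F}^k(\mathcal{C}(x))$, $x\in\mathbb{C}^n-\Delta$, is identified for all $x$ with the complex vector space with basis $F_{j_1,\dots,j_k}$, $\{j_1<\dots<j_k\}\subset J$ independent; $F_{j_1,\dots,j_k}$ is skew-symmetric in its indices, and is set to $0$ for dependent index sets. The contravariant form $S^{(a)}$ on $V$ is the symmetric bilinear form for which this basis is orthogonal and $S^{(a)}(F_{j_1,\dots,j_k},F_{j_1,\dots,j_k})=a_{j_1}\cdots a_{j_k}$. The singular subspace $\mathrm{Sing}_aV\subset V$ consists of the vectors orthogonal, with respect to $S^{(a)}$, to all $\sum_{j\in J}F_{j,i_1,\dots,i_{k-1}}$ with $\{i_1,\dots,i_{k-1}\}\subset J$ independent. $\pi:V\to\mathrm{Sing}_aV$ is the orthogonal projection with respect to $S^{(a)}$, and $v_{j_1,\dots,j_k}=\pi(F_{j_1,\dots,j_k})$. **Elementary subarrangements.** Let $\lambda=(\lambda_1,\dots,\lambda_m)$ be positive integers with sum $k$; $\lambda^h=\lambda_1+\dots+\lambda_h$, $\lambda^0=0$.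 An elementary subarrangement of type $\lambda$, $\mathcal{C}_{J_\lambda}(x)=(H_i(x))_{i\in J_\lambda}$, is given by an ordered tuple $(J_1,\dots,J_m)$ of pairwise disjoint subsets of $J$, $|J_h|=\lambda_h+1$, $J_\lambda=\cup_hJ_h$, such that, with $X_h^*=\mathrm{span}\{g_i\}_{i\in J_1\cup\dots\cup J_h}$, for every $h$: (i) $\dim X_h^*=\lambda^h$; (ii) for every $j\in J_h$, $\dim\mathrm{span}\{g_l : l\in(J_1\cup\dots\cup J_h)-\{j\}\}=\lambda^h$. The ordered tuple is part of the data (different tuples count as different elementary subarrangements, the order inside each $J_h$ being irrelevant). Its weight with respect to $\mathcal{C}(x)$ is $a(J_\lambda,J)=a_J\prod_{h=1}^{m-1}a(J_\lambda,J,h)$, $a(J_\lambda,J,h)=\sum_{i\in J,\ g_i\notin X_h^*}a_i$. **Prepotentials and potential of first kind.** Given an elementary subarrangement, choose a basis $s_1,\dots,s_k$ of $(\mathbb{C}^k)^*$ such that $s_1,\dots,s_{\lambda^h}$ is a basis of $X_h^*$ for each $h$ and the change of basis matrix from $t_1,\dots,t_k$ has determinant 1. Write $g_j=\sum_ic_j^is_i$ and $d_{j_1,\dots,j_{\lambda_h};h}=\det(c_{j_l}^{\lambda^{h-1}+i})_{i,l=1}^{\lambda_h}$ for $j_1,\dots,j_{\lambda_h}\in J_h$. Write $J_h=\{j_1^h,\dots,j_{\lambda_h+1}^h\}$, $D_{h,i}=d_{j_1^h,\dots,\widehat{j_i^h},\dots,j_{\lambda_h+1}^h;h}$. Choose numbers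 $e_j$, $j\in J_1\cup\dots\cup J_{h-1}$, with $\sum_{i=1}^{\lambda_h+1}(-1)^{i+1}D_{h,i}\,g_{j_i^h}+\sum_{j\in J_1\cup\dots\cup J_{h-1}}e_jg_j=0$ (they exist), and set $f_{\mathcal{C}_{J_\lambda,h}}(z)=\sum_{i=1}^{\lambda_h+1}(-1)^{i+1}D_{h,i}\,z_{j_i^h}+\sum_{j\in J_1\cup\dots\cup J_{h-1}}e_jz_j$, $$P_{\mathcal{C}_{J_\lambda}}=\prod_{h=1}^m\frac{\prod_{j\in J_h}a_j}{(2\lambda_h)!}\,\frac{(f_{\mathcal{C}_{J_\lambda,h}})^{2\lambda_h}}{\bigl(\prod_{i=1}^{\lambda_h+1}D_{h,i}\bigr)^2}.$$ The potential of first kind is $P=\sum\frac1{a(J_\lambda,J)}P_{\mathcal{C}_{J_\lambda}}$, the sum over all elementary subarrangements (of all types). It depends on the choices above; any choices are allowed. *)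

(* Defs.v *)
From HB Require Import structures.
From mathcomp Require Import all_boot all_order all_algebra all_fingroup.
From mathcomp Require Import reals complex mpoly.

Set Implicit Arguments.
Unset Strict Implicit.
Unset Printing Implicit Defensive.

Import GRing.Theory.

Local Open Scope ring_scope.

(* The linear functions g_1, ..., g_n on K^k are the rows of B : 'M_(n, k),   *)
(* i.e. g_j = \sum_i B j i * t_i; thus (K^k)^* is 'rV_k, with basis the       *)
(* coordinate functions t_i. All indices are counted from 0.                  *)

Section Arrangements.

Variables (K : fieldType) (n k : nat).
Implicit Types (B : 'M[K]_(n, k)) (x a : 'I_n -> K).

Definition hyperplane B x (j : 'I_n) : {pred 'cV[K]_k} :=
  [pred t : 'cV[K]_k | \sum_i B j i * t i 0 + x j == 0].

Definition vertex B x (p : 'cV[K]_k) : Prop :=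
  exists A : {set 'I_n},
    forall q, (forall j, j \in A -> q \in hyperplane B x j) <-> q = p.

(* Hyperplanes are counted with their labels: a hyperplane H_i(x) = H_j(x)    *)
(* with i != j counts twice.                                                  *)
Definition normal_crossings B x : Prop :=
  forall p, vertex B x p -> #|[set j | p \in hyperplane B x j]| = k.

(* Homogeneous equations, in the homogeneous coordinates (t_0 : t_1 : ... :   *)
(* t_k) of P^k, of the closures of the H_j(x) (index Some j) and of the       *)
(* hyperplane at infinity (index None).                                       *)
Definition proj_form B x (i : option 'I_n) : 'rV[K]_(1 + k) :=
  if i is Some j then row_mx (x j)%:M (row j B) else row_mx 1%:M 0.

Definition proj_weight a (i : option 'I_n) : K :=
  if i is Some j then a j else - \sum_j a j.

(* A subset of P^k is given by the nonzero vectors representing its points.   *)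
Definition edge B x (X : 'cV[K]_(1 + k) -> Prop) : Prop :=
  (exists p, X p) /\
  exists2 A : {set option 'I_n}, A != set0 &
    forall p, X p <->
      p != 0 /\ (forall i, i \in A -> proj_form B x i *m p = 0).

(* The equations of the hyperplanes indexed by A are expressed in the new     *)
(* coordinates given by M; the new coordinate number q is assigned to the     *)
(* part c q of the partition P.                                               *)
Definition reducible B x (A : {set option 'I_n}) : Prop :=
  exists (P : {set {set option 'I_n}}) (M : 'M[K]_(1 + k))
         (c : 'I_(1 + k) -> {set option 'I_n}),
    [/\ partition P A, (1 < #|P|)%N, M \in unitmx &
        forall Q i q, Q \in P -> i \in Q ->
          (proj_form B x i *m M) 0 q != 0 -> c q = Q].

Definition unbalanced B x a : Prop :=
  forall (X : 'cV[K]_(1 + k) -> Prop) (A : {set option 'I_n}),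
    edge B x X ->
    (forall i, i \in A <-> (forall p, X p -> proj_form B x i *m p = 0)) ->
    ~ reducible B x A ->
    \sum_(i in A) proj_weight a i != 0.

Definition independent B (s : seq 'I_n) : bool :=
  row_free (rowsub (tnth (in_tuple s)) B).

Definition minor B (s : k.-tuple 'I_n) : K :=
  \det (\matrix_(i < k, l < k) B (tnth s l) i).

Definition flag_index B : Type :=
  {s : k.-tuple 'I_n |
    sorted (fun i j : 'I_n => (i < j)%N) s && independent B s}.

Local Notation flag_space B := {ffun flag_index B -> K^o}.

(* The coordinate of F_s on the basis vector indexed by m is the sign of the  *)
(* permutation p such that s = (m_(p 0), ..., m_(p (k - 1))), and is 0 if     *)
(* there is none; in particular F_s = 0 when s is dependent or has a repeated *)
(* entry.                                                                     *)
Definition flag B (s : seq 'I_n) : flag_space B :=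
  [ffun m : flag_index B =>
    \sum_(p : 'S_k | s == [seq tnth (val m) (p l) | l <- enum 'I_k])
      (-1) ^+ p].

Definition contravariant B a (u w : flag_space B) : K :=
  \sum_(m : flag_index B) (\prod_(j <- val m) a j) * u m * w m.

Lemma contravariant_is_linear B a (u : flag_space B) :
  linear (contravariant a u : flag_space B -> K^o).
Proof.
move=> c v w; rewrite /contravariant scaler_sumr -big_split /=.
by apply: eq_bigr => m _; rewrite !ffunE mulrDr /GRing.scale /= mulrCA.
Qed.

HB.instance Definition _ B a (u : flag_space B) :=
  GRing.isLinear.Build K (flag_space B) K^o _
    (contravariant a u : flag_space B -> K^o) (contravariant_is_linear a u).

Definition orth B a (us : seq (flag_space B)) : {vspace flag_space B} :=
  (\bigcap_(u <- us)
     lker (linfun (contravariant a u : flag_space B -> K^o)))%VS.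

Lemma mem_orth B a (us : seq (flag_space B)) (w : flag_space B) :
  reflect (forall u, u \in us -> contravariant a u w = 0) (w \in orth a us).
Proof.
rewrite /orth; elim: us => [|u us IHus].
  by rewrite big_nil memvf; apply: ReflectT.
rewrite big_cons memv_cap memv_ker lfunE /=.
apply: (iffP andP) => [[/eqP uw /IHus usw] v|usw].
  by rewrite inE => /predU1P[->|/usw].
split; first by rewrite usw ?mem_head.
by apply/IHus => v vus; rewrite usw // inE vus orbT.
Qed.

Definition sing B a : {vspace flag_space B} :=
  orth a [seq \sum_j flag B (j :: s) |
           s : (k.-1).-tuple 'I_n <- enum {: (k.-1).-tuple 'I_n}
           & independent B s].

(* [daddv_pi U W] is the projection onto U along W when U and W are in direct *)
(* sum; here this holds as soon as the form is nondegenerate on [sing B a],   *)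
(* which is what being unbalanced guarantees.                                 *)
Definition sing_proj B a : 'End(flag_space B) :=
  daddv_pi (sing B a) (orth a (vbasis (sing B a))).

Definition sing_vector B a (s : seq 'I_n) : flag_space B :=
  sing_proj B a (flag B s).

Section ElementarySubarrangements.

Variable B : 'M[K]_(n, k).
Implicit Types (Js : seq {set 'I_n}) (h : nat).

Definition dual_span (A : {set 'I_n}) : 'M[K]_k :=
  (\sum_(i in A) <<row i B>>)%MS.

Definition block Js h : {set 'I_n} := nth set0 Js h.

(* lambda_(h + 1) *)
Definition part Js h : nat := #|block Js h|.-1.

(* lambda^h = lambda_1 + ... + lambda_h *)
Definition part_sum Js h : nat := (\sum_(r < h) part Js r)%N.

(* J_1 :|: ... :|: J_h *)
Definition block_union Js h : {set 'I_n} := \bigcup_(r < h) block Js r.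

Definition elementary Js : bool :=
  [&& all (fun A : {set 'I_n} => (1 < #|A|)%N) Js,
      pairwise (fun A A' : {set 'I_n} => [disjoint A & A']) Js,
      part_sum Js (size Js) == k &
      [forall h : 'I_(size Js),
        (\rank (dual_span (block_union Js h.+1)) == part_sum Js h.+1) &&
        [forall j in block Js h,
          \rank (dual_span (block_union Js h.+1 :\ j)) == part_sum Js h.+1]]].

Definition elementary_weight a Js : K :=
  (\sum_j a j) *
  \prod_(1 <= h < size Js)
    (\sum_(i | ~~ (row i B <= dual_span (block_union Js h))%MS) a i).

(* The choices entering the prepotential of an elementary subarrangement: the *)
(* rows of pc_basis are s_1, ..., s_k; pc_enum numbers the elements of each   *)
(* block (numbering by the block itself suffices, as blocks are distinct);    *)
(* pc_rel h gives the numbers e_j of the h-th linear relation.                *)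
Record prepotential_choice := PrepotentialChoice {
  pc_basis : 'M[K]_k;
  pc_enum : forall A : {set 'I_n}, 'I_#|A| -> 'I_n;
  pc_rel : nat -> 'I_n -> K
}.

Implicit Type c : prepotential_choice.

(* The matrix of the c_j^i, defined by g_j = \sum_i c_j^i s_i. *)
Definition adapted_coords c : 'M[K]_(n, k) := B *m invmx (pc_basis c).

(* The r-th entry (r : nat) of a row; it is 0 if r >= k. *)
Definition coord_at (A : 'M[K]_(n, k)) (j : 'I_n) (r : nat) : K :=
  oapp (fun i : 'I_k => A j i) 0 (insub r).

(* D_(h, i) *)
Definition block_minor Js c h (i : 'I_#|block Js h|) : K :=
  \det (\matrix_(r < part Js h, l < part Js h)
    coord_at (adapted_coords c) (pc_enum c (lift i l)) (part_sum Js h + r)).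

Definition valid_choice Js c : Prop :=
  [/\ \det (pc_basis c) = 1,
      forall h, (h <= size Js)%N ->
        (\sum_(q < k | (q < part_sum Js h)%N) <<row q (pc_basis c)>>
           == dual_span (block_union Js h))%MS,
      forall h, (h < size Js)%N ->
        injective (pc_enum c (A := block Js h)) /\
        (forall i : 'I_#|block Js h|, pc_enum c i \in block Js h) &
      forall h, (h < size Js)%N ->
        \sum_(i < #|block Js h|)
          ((-1) ^+ i * block_minor c i) *: row (pc_enum c i) B
        + \sum_(j in block_union Js h) pc_rel c h j *: row j B = 0].

Definition relation_form Js c h : {mpoly K[n]} :=
  \sum_(i < #|block Js h|)
    ((-1) ^+ i * block_minor c i) *: 'X_(pc_enum c i)
  + \sum_(j in block_union Js h) pc_rel c h j *: 'X_j.

Definition prepotential a Js c : {mpoly K[n]} :=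
  \prod_(h < size Js)
    (((\prod_(j in block Js h) a j) / ((2 * part Js h)`!)%:R
        / (\prod_(i < #|block Js h|) block_minor c i) ^+ 2)
       *: relation_form Js c h ^+ (2 * part Js h)).

(* As the lambda_h are positive with sum k, there are at most k of them. *)
Definition potential a (c : seq {set 'I_n} -> prepotential_choice) :
    {mpoly K[n]} :=
  \sum_(m < k.+1) \sum_(Js : m.-tuple {set 'I_n} | elementary Js)
    (elementary_weight a Js)^-1 *: prepotential a Js (c Js).

End ElementarySubarrangements.

(* d/dz_(s_1) ... d/dz_(s_r) p for s = [:: s_1; ...; s_r] *)
Definition iter_mderiv (s : seq 'I_n) (p : {mpoly K[n]}) : {mpoly K[n]} :=
  foldr (fun i q => mderiv i q) p s.

End Arrangements.

(* Main.v *)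
Require Import Defs.
From mathcomp Require Import all_boot all_order all_algebra all_fingroup.
From mathcomp Require Import reals complex mpoly.
From mathcomp Require Import ring zify.

Set Implicit Arguments.
Unset Strict Implicit.
Unset Printing Implicit Defensive.

Import GRing.Theory Num.Theory.

Local Open Scope ring_scope.

(** Write [S] for the contravariant form, [F_I] for flags and [a_m] for the
    product of the weights [a_j] over the entries of [m]. A vector [w] of the
    singular subspace is determined by the function [psi I = S(w, F_I)] on
    index tuples, which is skew-symmetric, vanishes on dependent tuples, and
    sums to zero when one entry runs through all indices; such functions are
    called [singular] below. By [projection_criterion], the numbers
    [G I L = S(v_I, v_L)] are characterized by two properties: each [G I] is
    singular, and [G] reproduces every singular [psi], that is,
    [psi I = \sum_m G I m / a_m * psi m]. The right-hand side of the theorem is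
    checked to have both.

    The [2k]-th derivative of the prepotential of one elementary
    subarrangement [E], multiplied by the two minors, is a rank one form
    [a(E) * phi_E I * phi_E L], where [a(E)] is the product of the weights in
    [E] ([mderiv_prepotential]). Indeed the [h]-th linear form only involves
    variables of the first [h] blocks, and an independent tuple has at most
    [lambda_1 + ... + lambda_h] entries there; this leaves a single way to
    distribute the derivations over the factors
    ([iter_mderiv_triangular]), and [phi_E I] is nonzero only if [I] omits
    exactly one element of each block. The [h]-th linear relation shows that
    [phi_E] is singular ([singular_elementary_functional]), and a block
    triangular determinant shows that, suitably scaled, it takes the values
    [1] and [-1] on these transversals ([functional_normalization]). So [phi_E]
    is the product over the blocks of the boundaries of the simplices [J_h].

    It remains to prove the reproducing property. Fix an independent [I] and
    let [supp p] be the support of [g_p] in the basis [g_i], [i] in [I]. The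
    elementary subarrangements in which [I] is transversal are the sequences
    [p_1, ..., p_m] of elements outside of [I] for which the supports of
    [p_1, ..., p_h] have unions [U_h] that increase strictly up to the whole
    of [I]: the block of [p_h] consists of [p_h] and of
    [supp p_h :\: U_(h - 1)] ([extends_next_block],
    [extends_only_next_block]). For fixed [E], the sum over [m] becomes a sum
    over the ways to exchange, in some of the blocks, one entry of [I] for
    [p_h] ([exchange_functional]). For [U = U_h] fixed, summing over the next
    element [p = p_(h + 1)] gives
    [\sum_p (a_p * psi I - \sum_(q in supp p :\: U) a_q * psi I_(q -> p))],
    where [I_(q -> p)] is [I] with [q] replaced by [p]. Since [psi] is
    singular, the exchanges at [q] add up to [- psi I], and the result is
    [psi I] times the sum of the [a_j] with [g_j] outside of the span of [U]
    ([exchange_step]). This is the factor of the weight of [E] which belongs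
    to [U], and the whole sum telescopes to [psi I] ([exchange_telescope]).

    The division by this factor is the only use of unbalancedness. The factor
    is, up to sign, the weight of the edge at infinity on which the elements
    of [U] vanish, and this edge is dense for generic [x] because the blocks of
    an elementary subarrangement contain no coloop ([unbalanced_weight]). *)

(** * Independent families and their minors *)

Section Span.

Variables (K : fieldType) (n k : nat) (B : 'M[K]_(n, k)).
Implicit Types (s t : seq 'I_n) (X Y : {set 'I_n}) (j : 'I_n).

(** A span along a list: unlike the span of a set it is additive under
    concatenation, which gives induction on independent lists. *)
Definition seq_span s : 'M[K]_k := (\sum_(i <- s) <<row i B>>)%MS.

Lemma seq_span_dual s : (seq_span s :=: dual_span B [set i in s])%MS.
Proof.
apply/eqmxP/andP; split.
  rewrite /seq_span big_seq;
    apply: (big_ind (fun M => (M <= _)%MS)) => [|M N ? ?|i si].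
  - exact: sub0mx.
  - by rewrite addsmx_sub; apply/andP.
  by rewrite (sumsmx_sup i) // inE.
apply/sumsmx_subP=> i; rewrite inE /seq_span; elim: s => //= j s IHs.
rewrite inE big_cons => /predU1P[->|/IHs]; first exact: addsmxSl.
by move/submx_trans; apply; apply: addsmxSr.
Qed.

Lemma independentE s : independent B s = (\rank (seq_span s) == size s).
Proof.
rewrite /independent /row_free; congr (_ == _); apply/eqmx_rank/andP; split.
  apply/row_subP=> l; rewrite row_rowsub seq_span_dual.
  by apply: (sumsmx_sup (tnth (in_tuple s) l)); rewrite ?inE ?mem_tnth ?genmxE.
rewrite seq_span_dual; apply/sumsmx_subP=> i;
  rewrite inE genmxE => /(tnthP (in_tuple s))[l ->].
by rewrite -row_rowsub row_sub.
Qed.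

Lemma independent_mem s :
  independent B s = (\rank (dual_span B [set i in s]) == size s).
Proof. by rewrite independentE seq_span_dual. Qed.

Lemma rank_seq_span s : (\rank (seq_span s) <= size s)%N.
Proof.
rewrite /seq_span; elim: s => [|j s IHs]; first by rewrite big_nil mxrank0.
rewrite big_cons (leq_trans (mxrank_adds_leqif _ _)) //= -(add1n (size s))
  leq_add //.
by rewrite genmxE rank_leq_row.
Qed.

Lemma rank_dual_span X : (\rank (dual_span B X) <= #|X|)%N.
Proof.
have := rank_seq_span (enum X); rewrite seq_span_dual -cardE.
by rewrite (_ : [set i in enum X] = X) //; apply/setP=> i; rewrite inE mem_enum.
Qed.

Lemma independent_perm s t : perm_eq s t -> independent B s = independent B t.
Proof.
by move=> st; rewrite !independentE (perm_size st) /seq_span (perm_big t).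
Qed.

Lemma independent_catl s t : independent B (s ++ t) -> independent B s.
Proof.
rewrite !independentE size_cat /seq_span big_cat /= -!/(seq_span _) => /eqP st.
have := mxrank_adds_leqif (seq_span s) (seq_span t); case; rewrite st => h _.
rewrite eqn_leq rank_seq_span -(leq_add2r (size t)).
by apply: leq_trans h _; rewrite leq_add2l rank_seq_span.
Qed.

Lemma independent_filter (P : pred 'I_n) s :
  independent B s -> independent B (filter P s).
Proof.
rewrite -(@independent_perm (filter P s ++ filter (predC P) s)
  s) ?perm_filterC //.
exact: independent_catl.
Qed.

Lemma independent_cons j s : independent B (j :: s) -> independent B s.
Proof.
have /independent_perm -> : perm_eq (j :: s) (s ++ [:: j])
  by rewrite -cat1s perm_catC.
exact: independent_catl.
Qed.

Lemma independent_uniq s : independent B s -> uniq s.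
Proof.
elim: s => //= j s IHs jsI; rewrite IHs ?(independent_cons jsI) // andbT.
apply/negP=> sj; move: jsI; rewrite independent_mem.
rewrite (_ : [set i in j :: s] = [set i in s]); last first.
  by apply/setP=> i; rewrite !inE; case: eqP => // ->; rewrite sj.
by rewrite -(seq_span_dual s) => /eqP h; have := rank_seq_span s;
  rewrite h ltnn.
Qed.

Lemma dual_spanS X Y : X \subset Y -> (dual_span B X <= dual_span B Y)%MS.
Proof.
by move/subsetP=> XY; apply/sumsmx_subP=> i /XY Yi; apply: (sumsmx_sup i).
Qed.

Lemma row_dual_span j X : j \in X -> (row j B <= dual_span B X)%MS.
Proof. by move=> Xj; apply: (sumsmx_sup j); rewrite ?genmxE. Qed.

Lemma dual_span_sub m X (M : 'M[K]_(m, k)) :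
  (forall j, j \in X -> (row j B <= M)%MS) -> (dual_span B X <= M)%MS.
Proof. by move=> XM; apply/sumsmx_subP=> i Xi; rewrite genmxE XM. Qed.

(** The entries in [X] of an independent list are independent vectors of the
    span of [X]. All vanishing statements about elementary subarrangements
    reduce to this bound. *)
Lemma independent_count X s :
  independent B s -> (count (mem X) s <= \rank (dual_span B X))%N.
Proof.
move/(independent_filter (mem X));
  rewrite independent_mem size_filter => /eqP <-.
by apply/mxrankS/dual_spanS/subsetP=> i; rewrite inE mem_filter => /andP[].
Qed.

Lemma row_dual_span_mul (j : 'I_n) X m (v : 'M[K]_(k, m)) :
  (forall i, i \in X -> row i B *m v = 0) ->
  (row j B <= dual_span B X)%MS -> row j B *m v = 0.
Proof.
move=> Xv jX; apply/eqP; rewrite -sub_kermx (submx_trans jX) //.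
by apply: dual_span_sub => i /Xv; rewrite sub_kermx => ->.
Qed.

Implicit Types (I L : k.-tuple 'I_n).

Lemma minorE I : minor B I = \det (rowsub (tnth I) B).
Proof.
by rewrite /minor -det_tr; congr (\det _); apply/matrixP=> i l; rewrite !mxE.
Qed.

Lemma independent_minor I : independent B I = (minor B I != 0).
Proof.
rewrite minorE -unitfE -unitmxE -row_free_unit independent_mem /row_free
  size_tuple.
congr (_ == _); apply/eqmx_rank/andP; split; last first.
  by apply/row_subP=> l; rewrite row_rowsub row_dual_span // inE mem_tnth.
apply: dual_span_sub => i; rewrite inE => /tnthP[l ->].
by rewrite -row_rowsub row_sub.
Qed.

Definition perm_tuple I (p : 'S_k) : k.-tuple 'I_n :=
  [tuple tnth I (p l) | l < k].

Lemma perm_eq_perm_tuple I p : perm_eq (perm_tuple I p) I.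
Proof. by apply/tuple_permP; exists p. Qed.

Lemma minor_perm I p : minor B (perm_tuple I p) = (-1) ^+ p * minor B I.
Proof.
rewrite !minorE -det_perm -det_mulmx -row_permE; congr (\det _).
by apply/matrixP=> i l; rewrite !mxE tnth_mktuple.
Qed.

Definition upd I (q : 'I_k) j : k.-tuple 'I_n :=
  [tuple if l == q then j else tnth I l | l < k].

Lemma tnth_upd I q j l : tnth (upd I q j) l = if l == q then j else tnth I l.
Proof. exact: tnth_mktuple. Qed.

Lemma upd_id I q : upd I q (tnth I q) = I.
Proof. by apply/eq_from_tnth=> l; rewrite tnth_upd; case: eqP => // ->. Qed.

Lemma count_tuple (P : pred 'I_n) I : count P I = (\sum_l P (tnth I l))%N.
Proof.
by rewrite -sum1_count big_mkcond big_tuple /=; apply: eq_bigr=> i; case: P.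
Qed.

(** Linearity of the determinant in the row [q]. *)
Lemma minor_upd_lin (e : 'I_n -> K) I q :
  \sum_j e j *: row j B = 0 -> \sum_j e j * minor B (upd I q j) = 0.
Proof.
move=> e0.
have D j : minor B (upd I q j) =
    \sum_r B j r * cofactor (rowsub (tnth I) B) q r.
  rewrite minorE (expand_det_row _ q); apply: eq_bigr => r _.
  rewrite !mxE tnth_upd eqxx; congr (_ * _).
  rewrite /cofactor; congr (_ * \det _); apply/matrixP=> x y;
    rewrite !mxE tnth_upd.
  by rewrite eq_sym (negPf (neq_lift _ _)).
under eq_bigr => j _ do rewrite D mulr_sumr.
rewrite exchange_big big1 //= => r _.
under eq_bigr => j _ do rewrite mulrA.
rewrite -mulr_suml; have /rowP/(_ r) := e0; rewrite summxE !mxE.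
under eq_bigr => j _ do rewrite !mxE.
by move=> ->; rewrite mul0r.
Qed.

End Span.

(** * Flags, the contravariant form and the singular subspace *)

Section Flags.

Variables (K : fieldType) (n k : nat) (B : 'M[K]_(n, k)) (a : 'I_n -> K).
Implicit Types (I L : k.-tuple 'I_n) (m : flag_index B).

Local Notation flag_space := {ffun flag_index B -> K^o}.
Implicit Types (u w : flag_space).

Lemma contravariantC u w : contravariant a u w = contravariant a w u.
Proof. by apply: eq_bigr => m _; rewrite -!mulrA (mulrC (u m)). Qed.

Lemma contravariantDr u w w' :
  contravariant a u (w + w') = contravariant a u w + contravariant a u w'.
Proof. exact: (linearD (contravariant a u : flag_space -> K^o)). Qed.

Lemma contravariantBr u w w' :
  contravariant a u (w - w') = contravariant a u w - contravariant a u w'.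
Proof. exact: (linearB (contravariant a u : flag_space -> K^o)). Qed.

Lemma contravariantZr u (c : K) w :
  contravariant a u (c *: w) = c * contravariant a u w.
Proof.
rewrite /contravariant mulr_sumr; apply: eq_bigr => m _.
by rewrite !ffunE /GRing.scale /= mulrCA.
Qed.

Lemma contravariant_sumr u (T : finType) (F : T -> flag_space) :
  contravariant a u (\sum_i F i) = \sum_i contravariant a u (F i).
Proof. exact: (linear_sum (contravariant a u : flag_space -> K^o)). Qed.

Lemma flag_perm I (p : 'S_k) :
  flag B (perm_tuple I p) = ((-1) ^+ p : K) *: flag B I.
Proof.
apply/ffunP=> m; rewrite !ffunE /GRing.scale /= mulr_sumr.
rewrite (reindex_inj (mulgI p)) /=; apply: eq_big => [r|r _]; last first.
  by rewrite odd_permM signr_addb.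
have E (t : 'S_k) (L : k.-tuple 'I_n) :
    (L == [seq tnth (val m) (t l) | l <- enum 'I_k] :> seq _) =
    [forall l, tnth L l == tnth (val m) (t l)].
  have -> : [seq tnth (val m) (t l) | l <- enum 'I_k] =
    [tuple tnth (val m) (t l) | l < k] by [].
  apply/eqP/forallP => [/val_inj -> l|h]; first by rewrite tnth_mktuple.
  by congr val; apply/eq_from_tnth => l; rewrite tnth_mktuple; apply/eqP/h.
rewrite (E r I); apply: etrans (E (p * r)%g (perm_tuple I p)) _;
  apply/idP/idP => /forallP h; apply/forallP=> l; last first.
  by rewrite tnth_mktuple permM; apply: h.
by have := h (p^-1 l)%g; rewrite tnth_mktuple permM permKV.
Qed.

Lemma flag_sorted m m' : flag B (val m) m' = (m == m')%:R.
Proof.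
rewrite ffunE; have [/andP[ms _] /andP[ms' mi']] := (valP m, valP m').
have mu : uniq (val m) by apply: sorted_uniq ms => [x y z|x];
  [apply: ltn_trans|rewrite ltnn].
have mu' : uniq (val m') by exact: independent_uniq mi'.
case: eqP => [<-|neq_m].
  rewrite (big_pred1 1%g) ?odd_perm1 // => p /=; apply/eqP/eqP => [E|->];
    last first.
    have -> : [seq tnth (val m) ((1%g : 'S_k) l) | l <- enum 'I_k] =
      [tuple tnth (val m) l | l < k].
      by rewrite /=; apply: eq_map => l; rewrite perm1.
    exact: (congr1 val (tuple_map_ord (val m))).
  apply/permP=> l; rewrite perm1.
  have {}E : val m = [tuple tnth (val m) (p l) | l < k] by apply: val_inj.
  have := congr1 (fun t : k.-tuple 'I_n => tnth t l) E; rewrite tnth_mktuple.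
  by move/(tuple_uniqP _ mu).
rewrite big1 // => p /eqP E; case: neq_m; apply/val_inj/val_inj.
have /perm_mem mm' : perm_eq (val m) (val m').
  by apply/tuple_permP; exists p.
have tr : transitive (fun i j : 'I_n => (i < j)%N) by move=> x y z;
  apply: ltn_trans.
have ir : irreflexive (fun i j : 'I_n => (i < j)%N) by move=> x; rewrite ltnn.
exact: (irr_sorted_eq tr ir ms ms' mm').
Qed.

Lemma independent_sort I : independent B I ->
  exists m (p : 'S_k), I = perm_tuple (val m) p.
Proof.
move=> II; have Iu := independent_uniq II.
have st : sorted (fun i j : 'I_n => (i < j)%N)
  (sort (fun i j : 'I_n => (i <= j)%N) I).
  have tot : total (fun i j : 'I_n => (i <= j)%N) by move=> x y;
    apply: leq_total.
  have := sort_sorted tot (val I);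
    rewrite -(sort_uniq (fun i j : 'I_n => (i <= j)%N)) in Iu.
  move: Iu; move: (sort _ _) => s su ss.
  rewrite -(map_inj_uniq val_inj) in su.
  have : sorted ltn (map val s) by rewrite ltn_sorted_uniq_leq su sorted_map.
  by rewrite sorted_map.
have sz : size (sort (fun i j : 'I_n => (i <= j)%N) I) == k
  by rewrite size_sort size_tuple.
have mP : sorted (fun i j : 'I_n => (i < j)%N) (Tuple sz) && independent B
  (Tuple sz).
  by rewrite st /= -(independent_perm B (s := I)) // perm_sym perm_sort.
have /tuple_permP[p Ep] : perm_eq I (Tuple sz) by rewrite perm_sym /= perm_sort.
by exists (Sub (Tuple sz) mP), p; apply/val_inj.
Qed.

Lemma flag_dependent I : ~~ independent B I -> flag B I = 0.
Proof.
move=> dI; apply/ffunP=> m; rewrite !ffunE big1 // => p /eqP E.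
case/negP: dI; have /andP[_ mI] := valP m.
by rewrite (@independent_perm _ _ _ B I (val m)) //; apply/tuple_permP;
  exists p.
Qed.

Lemma contravariant_flag w m :
  contravariant a w (flag B (val m)) = (\prod_(j <- val m) a j) * w m.
Proof.
rewrite /contravariant (bigD1 m) //= flag_sorted eqxx mulr1
  [X in _ + X]big1 ?addr0 // => m' ne.
by rewrite flag_sorted eq_sym (negPf ne) mulr0.
Qed.

(** These are the functions [psi I = S(w, F_I)] for [w] in the singular
    subspace. Orthogonality to the vectors [\sum_j F_(j, s)] is stated with the
    summation index at an arbitrary position [q] instead of the first one. *)
Definition singular (psi : k.-tuple 'I_n -> K) : Prop :=
  [/\ forall I p, psi (perm_tuple I p) = (-1) ^+ p * psi I,
      forall I, ~~ independent B I -> psi I = 0 &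
      forall I q, \sum_j psi (upd I q j) = 0].

Lemma perm_eq_perm_tupleP I L : perm_eq I L -> exists p, I = perm_tuple L p.
Proof. by case/tuple_permP=> p E; exists p; apply: val_inj. Qed.

(** Exactly one flag index is a reordering of a given independent [I]. *)
Lemma sum_flag_perm_eq (f : k.-tuple 'I_n -> K) I :
  (forall L p, f (perm_tuple L p) = f L) ->
  (forall L, ~~ independent B L -> f L = 0) ->
  \sum_(m : flag_index B | perm_eq (val m) I) f (val m) = f I.
Proof.
move=> fp f0; case: (boolP (independent B I)) => [II|dI]; last first.
  rewrite f0 // big1 // => m /(independent_perm B) E.
  by have /andP[_] := valP m; rewrite E (negPf dI).
have [m [p E]] := independent_sort II.
rewrite (big_pred1 m) => [|m' /=]; first by rewrite E fp.
rewrite E; apply/idP/eqP => [h|->]; last first.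
  by rewrite perm_sym perm_eq_perm_tuple.
have {}h := perm_trans h (perm_eq_perm_tuple _ _).
apply/val_inj/val_inj; have [/andP[ms _] /andP[ms' _]] := (valP m, valP m').
by apply: (irr_sorted_eq _ _ ms' ms (perm_mem h)) => [x y z|x];
  [exact: ltn_trans|rewrite ltnn].
Qed.

End Flags.

Section Projection.

Variables (K : fieldType) (n k' : nat).
Local Notation k := k'.+1.
Variables (B : 'M[K]_(n, k)) (a : 'I_n -> K).
Hypothesis a_neq0 : forall j, a j != 0.
Implicit Types (I L : k.-tuple 'I_n) (m : flag_index B).

Local Notation flag_space := {ffun flag_index B -> K^o}.
Implicit Types (u w : flag_space).

Lemma mem_singP w : reflect
  (forall s : k'.-tuple 'I_n, independent B s ->
    \sum_j contravariant a w (flag B (j :: s)) = 0)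
  (w \in sing B a).
Proof.
apply: (iffP (mem_orth _ _ _)) => h => [s sI|u /mapP[s]].
  rewrite -contravariant_sumr contravariantC; apply: h.
  by apply/mapP; exists s; rewrite // mem_filter sI mem_enum.
by rewrite mem_filter => /andP[sI _] ->;
  rewrite contravariantC contravariant_sumr h.
Qed.

Lemma sing_singular w : w \in sing B a ->
  singular B (fun I => contravariant a w (flag B I)).
Proof.
move=> /mem_singP ws; split=> [I p|I dI|I q].
- by rewrite flag_perm contravariantZr.
- by rewrite flag_dependent // -[0 in LHS](scale0r 0) contravariantZr mul0r.
(* Moving the position q to the front is a permutation independent of j. *)
pose s := [tuple tnth I (lift q l) | l < k'].
pose p : 'S_k := lift_perm q ord0 1.
have E j : upd I q j = perm_tuple [tuple of j :: s] p.
  apply/eq_from_tnth=> l; rewrite tnth_upd tnth_mktuple.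
  case: (unliftP q l) => [l' ->|->]; last by rewrite eqxx lift_perm_id.
  by rewrite eq_sym (negPf (neq_lift _ _)) lift_perm_lift perm1 tnthS
    tnth_mktuple.
under eq_bigr => j _ do rewrite E flag_perm contravariantZr.
rewrite -mulr_sumr; case: (boolP (independent B s)) => [sI|ds]; first
  by rewrite ws // mulr0.
rewrite big1 ?mulr0 // => j _; rewrite flag_dependent.
  by rewrite -[0 in LHS](scale0r 0) contravariantZr mul0r.
by apply: contra ds => /independent_cons.
Qed.

Lemma orth_singP w : reflect
  (forall u, u \in sing B a -> contravariant a u w = 0)
  (w \in orth a (vbasis (sing B a))).
Proof.
apply: (iffP (mem_orth _ _ _)) => h u us; last by apply: h; apply: vbasis_mem.
rewrite (coord_vbasis us) contravariantC contravariant_sumr big1 // => i _.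
by rewrite contravariantZr contravariantC h ?mulr0 // mem_nth // size_tuple.
Qed.

(** Let [v_I = \sum_m (G I m / a_m) F_m]. Singularity of [G I] puts [v_I] in the
    singular subspace, and the reproducing property says that [F_I - v_I] is
    orthogonal to it. Since the [F_I] span the whole space, these decompositions
    also show that the form is nondegenerate on the singular subspace: a
    singular vector orthogonal to it is orthogonal to every [F_I]. So the sum is
    direct and [v_I] is the projection of [F_I]. *)
Lemma projection_criterion (G : k.-tuple 'I_n -> k.-tuple 'I_n -> K) :
  (forall I, independent B I -> singular B (G I)) ->
  (forall psi I, singular B psi -> independent B I ->
     psi I = \sum_(m : flag_index B) G I (val m) / (\prod_(j <- val m) a j) *
       psi (val m)) ->
  forall I L, independent B I -> independent B L ->
    contravariant a (sing_vector B a I) (sing_vector B a L) = G I L.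
Proof.
move=> Gs Grep.
have am m : \prod_(j <- val m) a j != 0.
  by rewrite prodf_seq_neq0; apply/allP=> j _; rewrite a_neq0.
pose v I : flag_space := [ffun m => G I (val m) / (\prod_(j <- val m) a j)].
have vE I m : v I m = G I (val m) / (\prod_(j <- val m) a j) by rewrite ffunE.
have vG I L : independent B I -> contravariant a (v I) (flag B L) = G I L.
  move=> II; have [Gp G0 _] := Gs I II.
  case: (boolP (independent B L)) => [LI|dL]; last first.
    by rewrite flag_dependent // G0 // -[0 in LHS](scale0r 0) contravariantZr
      mul0r.
  have [m [p ->]] := independent_sort LI.
  by rewrite flag_perm Gp contravariantZr contravariant_flag vE (mulrC (G _ _))
    mulVKf.
have vsing I : independent B I -> v I \in sing B a.
  move=> II; apply/mem_singP=> s _; have [_ _ G1] := Gs I II.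
  case: (pickP (fun _ : 'I_n => true)) => [j0 _|no];
    last by rewrite big1 // => j; have := no j.
  rewrite -[RHS](G1 [tuple of j0 :: s] ord0); apply: eq_bigr => j _.
  rewrite -(vG _ _ II); congr (contravariant a _ (flag B _)).
  have -> : upd [tuple of j0 :: s] ord0 j = [tuple of j :: s] => //.
  apply/eq_from_tnth=> l; rewrite tnth_upd;
    case: (unliftP ord0 l) => [l' ->|-> //].
  by rewrite eq_sym (negPf (neq_lift _ _)) !tnthS.
have vorth I : independent B I -> flag B I - v I \in orth a (vbasis (sing B a)).
  move=> II; apply/orth_singP=> w ws; rewrite contravariantBr.
  rewrite (Grep _ I (sing_singular ws) II) -sumrB big1 // => m _.
  by rewrite contravariant_flag vE; apply/eqP; rewrite subr_eq0; apply/eqP;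
    rewrite mulrC -!mulrA; congr (_ * _); rewrite mulrC.
(* A singular w orthogonal to Sing is orthogonal to v_m and to F_m - v_m. *)
have dir : (sing B a :&: orth a (vbasis (sing B a)) = 0)%VS.
  apply/eqP; rewrite -subv0; apply/subvP=> w /memv_capP[ws wo]; rewrite memv0.
  apply/eqP/ffunP=> m; rewrite ffunE.
  have /andP[_ mI] := valP m.
  have : contravariant a w (flag B (val m)) = 0.
    rewrite -[flag B (val m)](subrK (v (val m))) contravariantDr.
    rewrite (orth_singP _ (vorth _ mI)) // add0r contravariantC.
    exact: (orth_singP _ wo (v _) (vsing _ mI)).
  by rewrite contravariant_flag => /eqP;
    rewrite mulf_eq0 (negPf (am _)) => /eqP.
have svE I : independent B I -> sing_vector B a I = v I.
  move=> II; rewrite /sing_vector /sing_proj.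
  have := daddv_pi_add dir (w := flag B I);
    rewrite -{1}[flag B I](subrK (v I)) addrC.
  set x := daddv_pi _ _ _; set y := daddv_pi _ _ _ => /(_ _) h.
  have xy : x + y = flag B I.
    by apply: h; apply: memv_add; [exact: vsing|exact: vorth].
  have xs : x \in sing B a by exact: memv_pi.
  have yo : y \in orth a (vbasis (sing B a)) by exact: memv_pi.
  apply/eqP; rewrite -subr_eq0 -memv0 -dir memv_cap rpredB ?vsing //=.
  have -> : x - v I = (flag B I - v I) - y by rewrite -xy [in RHS]addrAC addrK.
  by rewrite rpredB ?vorth.
move=> I L II LI; rewrite !svE // -(vG I L II).
apply/eqP; rewrite eq_sym -subr_eq0 -contravariantBr.
by apply/eqP/orth_singP; [exact: vorth|exact: vsing].
Qed.

End Projection.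

(** * Weights of flats without coloops *)

Section Unbalanced.

Variables (K : numFieldType) (n k : nat) (B : 'M[K]_(n, k)).
Implicit Types (S : {set 'I_n}).

Lemma exists_nonroot (p : {poly K}) : p != 0 -> exists y, ~~ root p y.
Proof.
move=> p0; pose s := [seq i%:R : K | i <- iota 0 (size p)].
have us : uniq s by rewrite map_inj_uniq ?iota_uniq //;
  exact: (mulrIn (oner_neq0 K)).
have /allPn[y _ py] : ~~ all (root p) s.
  by apply/negP=> /(max_poly_roots p0)/(_ us); rewrite size_map size_iota ltnn.
by exists y.
Qed.

Definition relation_on S (c : 'rV[K]_n) : Prop :=
  c *m B = 0 /\ forall l, l \notin S -> c 0 l = 0.

Definition coord_mx S : 'M[K]_n := diag_mx (\row_l (l \in S)%:R).

(** For [x_l = y ^+ l] a nonzero relation [c] gives the nonzero polynomial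
    [\sum_l c_l 'X^l] in [y]. Choosing one relation for each dependent [S] leaves
    finitely many polynomials, which have a common nonroot. *)
Lemma generic_point : exists x : 'I_n -> K, forall S,
  (exists2 c, relation_on S c & c != 0) ->
  exists2 c, relation_on S c & \sum_l c 0 l * x l != 0.
Proof.
pose V S := (kermx B :&: coord_mx S)%MS.
have VP S c : (c <= V S)%MS -> relation_on S c.
  rewrite sub_capmx sub_kermx => /andP[/eqP cB /submxP[d E]]; split=> // l lS.
  rewrite E /coord_mx mul_mx_diag !mxE (negPf lS) mulr0 //.
have VP' S c : relation_on S c -> (c <= V S)%MS.
  case=> cB cS; rewrite sub_capmx sub_kermx cB eqxx /=; apply/submxP; exists c.
  apply/rowP=> l; rewrite /coord_mx mul_mx_diag !mxE;
    case: (boolP (l \in S)) => [|/cS ->]; rewrite ?mulr1 ?mul0r //.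
pose v S := nz_row (V S).
have [y py] : exists y, ~~ root (\prod_(S | v S != 0) rVpoly (v S)) y.
  apply: exists_nonroot; apply/prodf_neq0=> S vS; apply: contraNneq vS => E.
  by rewrite -[v S]rVpolyK E linear0.
exists (fun l => y ^+ l) => S [c cS c0]; exists (v S);
  first exact/VP/nz_row_sub.
have vS : v S != 0.
  rewrite nz_row_eq0; apply: contraNneq c0 => V0.
  by have := VP' S c cS; rewrite V0 submx0.
apply: contraNneq py => E; rewrite /root horner_prod (bigD1 S) //= horner_poly.
rewrite (_ : \sum_(i < n) _ = 0) ?mul0r //; rewrite -[RHS]E;
  apply: eq_bigr => l _.
by rewrite valK.
Qed.

(** If [p] is on the hyperplanes of [S], then [x_l = - g_l(p)] for [l] in
    [S]. *)
Lemma relation_at_point (x : 'I_n -> K) S (p : 'cV_k) c :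
  (forall l, l \in S -> p \in hyperplane B x l) -> relation_on S c ->
  \sum_l c 0 l * x l = 0.
Proof.
move=> pS [cB c0].
have: (c *m (B *m p)) 0 0 = 0 by rewrite mulmxA cB mul0mx mxE.
rewrite mxE => E; rewrite -[LHS]addr0 -[X in _ + X]E -big_split /=.
rewrite big1 // => l _; rewrite -mulrDr.
case: (boolP (l \in S)) => [/pS|/c0 ->]; last by rewrite mul0r.
by rewrite inE => /eqP; rewrite addrC mxE => ->; rewrite mulr0.
Qed.

Lemma relation_on_rank S :
  (\rank (dual_span B S) < #|S|)%N -> exists2 c, relation_on S c & c != 0.
Proof.
move=> lt_rk; pose M := rowsub (@enum_val _ (mem S)) B.
have rM : (\rank M <= \rank (dual_span B S))%N.
  apply/mxrankS/row_subP=> l; rewrite row_rowsub row_dual_span //;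
    exact: enum_valP.
have: kermx M != 0 by rewrite kermx_eq0 /row_free;
  rewrite neq_ltn (leq_ltn_trans rM).
rewrite -nz_row_eq0; move: (nz_row_sub (kermx M)); move: (nz_row _) => d.
rewrite sub_kermx => /eqP dM d0.
pose E : 'M[K]_(#|S|, n) := \matrix_(i, j) (enum_val i == j)%:R.
have EB : E *m B = M.
  apply/matrixP=> i j;
    rewrite !mxE (bigD1 (enum_val i)) //= !mxE eqxx mul1r big1 ?addr0 // => l
    ne.
  by rewrite !mxE eq_sym (negPf ne) mul0r.
have dE i : (d *m E) 0 (enum_val i) = d 0 i.
  rewrite mxE (bigD1 i) //= !mxE eqxx mulr1 big1 ?addr0 // => l ne.
  by rewrite !mxE (inj_eq enum_val_inj) (negPf ne) mulr0.
exists (d *m E).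
  split; first by rewrite -mulmxA EB.
  move=> l lS; rewrite mxE big1 // => i _; rewrite !mxE; case: eqP => [E'|];
    rewrite ?mulr0 //.
  by case/negP: lS; rewrite -E' enum_valP.
apply: contraNneq d0 => dE0; apply/eqP/rowP=> i; by rewrite -dE dE0 !mxE.
Qed.

(** More than [k] hyperplanes are dependent; if they met in a point, all
    their relations would vanish at [x] by [relation_at_point]. *)
Lemma generic_normal_crossings (x : 'I_n -> K) :
  (forall S, (exists2 c, relation_on S c & c != 0) ->
     exists2 c, relation_on S c & \sum_l c 0 l * x l != 0) ->
  normal_crossings B x.
Proof.
move=> gx p [A Ap]; set S := [set j | _].
have AS : A \subset S.
  by apply/subsetP=> j jA; rewrite inE; apply: ((Ap p).2 erefl).
have pS l : l \in S -> p \in hyperplane B x l by rewrite inE.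
apply/eqP; rewrite eqn_leq; apply/andP; split.
  rewrite leqNgt; apply/negP=> ltk.
  have [] := gx S; first
    by apply/relation_on_rank/(leq_ltn_trans _ ltk)/rank_leq_col.
  by move=> c cS; rewrite (relation_at_point pS cS) eqxx.
apply: leq_trans (subset_leq_card AS).
apply: leq_trans (rank_dual_span B A); rewrite leqNgt; apply/negP=> ltk.
have : cokermx (dual_span B A) != 0.
  by rewrite -mxrank_eq0 mxrank_coker subn_eq0 -ltnNge.
move/eqP=> nz; apply: nz; apply/matrixP=> r q; rewrite [RHS]mxE.
pose w := col q (cokermx (dual_span B A)).
have wA j : j \in A -> \sum_i B j i * w i 0 = 0.
  move=> jA; have : (row j B *m w) 0 0 = 0.
    rewrite /w colE mulmxA; have := row_dual_span B jA;
      rewrite submxE => /eqP ->.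
    by rewrite mul0mx mxE.
  by rewrite mxE; under eq_bigr => i _ do rewrite mxE.
have E : p + w = p.
  apply/Ap => j jA; have := pS j (subsetP AS j jA); rewrite !inE => /eqP pj;
    apply/eqP.
  rewrite -[RHS]pj; congr (_ + _); under eq_bigr => i _ do rewrite mxE mulrDr.
  by rewrite big_split /= wA // addr0.
have : w = 0 by apply: (addrI p); rewrite E addr0.
by move/matrixP/(_ r 0); rewrite !mxE.
Qed.

(** The hyperplanes through the edge at infinity cut out by the span of [S]. *)
Definition infinity_flat S : {set option 'I_n} :=
  None |: [set Some j | j : 'I_n & (row j B <= dual_span B S)%MS].

Lemma mem_infinity_flat S j : (Some j \in infinity_flat S) =
  (row j B <= dual_span B S)%MS.
Proof.
rewrite /infinity_flat !inE /=; apply/imsetP/idP => [[l]|h]; first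
  by rewrite inE => h [->].
by exists j; rewrite ?inE.
Qed.

Lemma relation_noncoloop S j :
  (forall i, i \in S -> (row i B <= dual_span B (S :\ i))%MS) ->
  (row j B <= dual_span B S)%MS ->
  exists2 c, relation_on (j |: S) c & c 0 j != 0.
Proof.
move=> Sc jS.
have {}jS : (row j B <= dual_span B (S :\ j))%MS.
  case: (boolP (j \in S)) => [/Sc //|jnS]; suff -> : S :\ j = S by [].
  by apply/setP=> i; rewrite !inE; case: eqP => // ->; rewrite (negPf jnS).
have : (dual_span B (S :\ j) <= coord_mx (S :\ j) *m B)%MS.
  apply: dual_span_sub => i iS; apply/submxP; exists (delta_mx 0 i).
  rewrite mulmxA -rowE; apply/rowP=> l;
    rewrite !mxE (bigD1 i) //= big1 ?addr0 => [|l' ne].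
    by rewrite !mxE eqxx iS mul1r.
  by rewrite !mxE eq_sym (negPf ne) mul0r.
move/(submx_trans jS)/submxP=> [d E].
exists (delta_mx 0 j - d *m coord_mx (S :\ j)).
  split; first by rewrite mulmxBl -rowE -mulmxA -E subrr.
  move=> l; rewrite !inE negb_or => /andP[ne lS].
  by rewrite /coord_mx mul_mx_diag !mxE !inE (negPf lS) andbF mulr0 subr0 eqxx
    (negPf ne).
by rewrite /coord_mx mul_mx_diag !mxE !inE !eqxx /= mulr0 subr0 oner_neq0.
Qed.

Lemma relation_proj (x : 'I_n -> K) c S : relation_on S c ->
  \sum_l c 0 l *: proj_form B x (Some l) = (\sum_l c 0 l * x l) *:
    proj_form B x None.
Proof.
case=> cB _; rewrite /= scale_row_mx scaler0.
apply/rowP=> i; rewrite summxE; case: (split_ordP i) => r ->.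
  rewrite row_mxEl !mxE; rewrite ord1 eqxx mulr1; apply: eq_bigr => l _.
  by rewrite mxE row_mxEl !mxE eqxx.
rewrite row_mxEr mxE; have /rowP/(_ r) := cB; rewrite !mxE => E;
  rewrite -[RHS]E.
by apply: eq_bigr => l _; rewrite mxE row_mxEr !mxE.
Qed.

(** The edge at infinity cut out by the span of [S] lies on the hyperplane at
    infinity and on the [H_j] with [g_j] in this span, so its weight is minus the
    sum in the conclusion. It remains to see that it is dense for generic [x].

    Suppose that a change of coordinates separates the part [Q0] of the
    hyperplane at infinity from another part [Q1]. A relation [c] among the
    [g_l] lifts to a relation expressing a multiple of the form at infinity by
    projective forms ([relation_proj]). Its component in the coordinates of
    [Q1] has to vanish, so the restriction of [c] to [Q1] is again a relation,
    and it vanishes at [x]. As [S] has no coloop, some [c] has a nonzero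
    restriction to [Q1]; hence [Q1] is dependent while all its relations vanish
    at [x], against the choice of [x]. *)
Lemma unbalanced_weight (a : 'I_n -> K) S :
  (forall x : 'I_n -> K, normal_crossings B x -> unbalanced B x a) ->
  (forall i, i \in S -> (row i B <= dual_span B (S :\ i))%MS) ->
  (\rank (dual_span B S) < k)%N ->
  \sum_(i | ~~ (row i B <= dual_span B S)%MS) a i != 0.
Proof.
move=> unb Sc ltk; have [x gx] := generic_point.
have nc := generic_normal_crossings gx.
pose A := infinity_flat S.
pose Xp (p : 'cV[K]_(1 + k)) := p != 0 /\ (forall i, i \in A ->
  proj_form B x i *m p = 0).
have : \sum_(i in A) proj_weight a i != 0.
  have pf0 (p : 'cV[K]_k) j : proj_form B x (Some j) *m col_mx 0 p =
    row j B *m p.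
    by rewrite /= mul_row_col mulmx0 add0r.
  have pfN (p : 'cV[K]_k) : proj_form B x None *m col_mx 0 p = 0.
    by rewrite /= mul_row_col mulmx0 mul0mx addr0.
  have coker_in q : col q (cokermx (dual_span B S)) != 0 ->
    Xp (col_mx 0 (col q (cokermx (dual_span B S)))).
    move=> nz; split; first by rewrite col_mx_eq0 negb_and nz orbT.
    case=> [j|]; last by rewrite pfN.
    rewrite mem_infinity_flat submxE pf0; move: (cokermx _) => N.
    by rewrite colE mulmxA => /eqP ->; rewrite mul0mx.
  apply: (unb x nc Xp).
  - split; last by exists A => //; apply/set0Pn; exists None; rewrite /A !inE.
    have : cokermx (dual_span B S) != 0.
      by rewrite -mxrank_eq0 mxrank_coker subn_eq0 -ltnNge.
    move=> nz; case: (pickP (fun q => col q (cokermx (dual_span B S)) != 0))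
      => [q /coker_in h|h].
      by eexists; exact: h.
    case/eqP: nz; apply/matrixP=> r q; have /negbFE/eqP/colP/(_ r) := h q;
      by rewrite !mxE.
  - case=> [j|]; last by split=> [_ p [_ h]|_]; [apply: h|]; rewrite /A !inE.
    split=> [jA p [_ h]|h]; first exact: h.
    rewrite mem_infinity_flat submxE; apply/eqP/rowP=> q; rewrite [RHS]mxE.
    case: (boolP (col q (cokermx (dual_span B S)) == 0))
      => [/eqP E|/coker_in/h].
      rewrite !mxE big1 // => r _; have /colP/(_ r) := E; rewrite !mxE => ->;
        exact: mulr0.
    rewrite pf0; move: (cokermx _) => N.
    by rewrite colE mulmxA -colE => /colP/(_ 0); rewrite !mxE.
  case=> P [M [c [partP ltP Mu cP]]].
  have [/eqP covP /trivIsetP trP P0] := and3P partP.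
  have : None \in cover P by rewrite covP /A !inE.
  case/bigcupP=> Q0 Q0P NQ0.
  have [Q1 Q1P neQ] : exists2 Q1, Q1 \in P & Q1 != Q0.
    have : (0 < #|P :\ Q0|)%N by move: ltP; rewrite (cardsD1 Q0) Q0P.
    by case/card_gt0P=> Q1; rewrite !inE => /andP[? ?]; exists Q1.
  have disQ Q i : Q \in P -> Q != Q1 -> i \in Q1 -> i \notin Q.
    move=> QP neq iQ1; have /disjointFr -> // : [disjoint Q1 & Q].
    by apply: trP => //; rewrite eq_sym.
  have NQ1 : None \notin Q1.
    by apply/negP=> /(disQ _ _ Q0P); rewrite eq_sym neQ NQ0 => /(_ isT).
  have subA Q : Q \in P -> Q \subset A by move=> QP; rewrite -covP;
    exact: bigcup_sup.
  have cP0 Q i q : Q \in P -> i \in Q -> c q != Q ->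
    (proj_form B x i *m M) 0 q = 0.
    move=> QP iQ ne; apply/eqP; apply: contraNT ne => /(cP Q i q QP iQ) ->;
      exact: eqxx.
  (* The component in the coordinates of Q1 of the lifted relation. *)
  have split_rel e S' : relation_on S' e ->
    (forall l, l \in S' -> Some l \in A) ->
      \sum_(l | Some l \in Q1) e 0 l *: proj_form B x (Some l) = 0.
    move=> eS S'A; apply: (can_inj (mulmxK Mu)); rewrite mul0mx.
    have E := relation_proj x eS.
    apply/rowP=> q; rewrite mulmx_suml summxE [RHS]mxE.
    case: (eqVneq (c q) Q1) => [cq|cq]; last first.
      rewrite big1 // => l lQ1; rewrite -scalemxAl mxE.
      by rewrite (cP0 Q1) ?mulr0.
    have {E} := congr1 (fun v => (v *m M) 0 q) E; rewrite mulmx_suml summxE.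
    rewrite -scalemxAl [in RHS]mxE.
    rewrite (cP0 Q0 None) ?cq // mulr0 => E;
      rewrite -[RHS]E [RHS](bigID (fun l => Some l \in Q1)) /=.
    rewrite [X in _ + X]big1 ?addr0 // => l lQ1.
    rewrite -scalemxAl mxE; case: (boolP (l \in S')) => [/S'A|/(proj2 eS) ->];
      last by rewrite mul0r.
    rewrite -covP => /bigcupP[Q QP lQ].
    rewrite (cP0 Q (Some l)) ?mulr0 // cq; by apply: contraNneq lQ1 => ->.
  pose S1 := [set l | Some l \in Q1].
  have [i1 i1Q] : exists i, i \in Q1.
    by apply/set0Pn; apply: contraNneq P0 => <-.
  case: i1 i1Q => [j jQ1|h]; last by rewrite h in NQ1.
  have jA : Some j \in A := subsetP (subA _ Q1P) _ jQ1.
  have S1A l : l \in S1 -> Some l \in A by rewrite inE;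
    exact: (subsetP (subA _ Q1P)).
  have sumS1 e S' : relation_on S' e -> (forall l, l \in S' -> Some l \in A) ->
      relation_on S1 (\row_l (if Some l \in Q1 then e 0 l else 0)) /\
      \sum_(l | Some l \in Q1) e 0 l * x l = 0.
    move=> eS S'A; have E := split_rel e S' eS S'A; split; last first.
      have /rowP/(_ (lshift k 0)) := E; rewrite summxE mxE => E';
        rewrite -[RHS]E'.
      by apply: eq_bigr => l _; rewrite mxE row_mxEl !mxE eqxx.
    split; last by move=> l; rewrite inE mxE => /negPf ->.
    apply/rowP=> r; have /rowP/(_ (rshift 1 r)) := E;
      rewrite summxE !mxE big_mkcond => E'; rewrite -[RHS]E'.
    by apply: eq_bigr => l _; rewrite mxE; case: ifP;
      rewrite ?mul0r // mxE row_mxEr !mxE.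
  have [e eS ej] : exists2 e, relation_on (j |: S) e & e 0 j != 0.
    by apply: relation_noncoloop => //; rewrite -mem_infinity_flat.
  have jSA l : l \in j |: S -> Some l \in A.
    by rewrite in_setU1 => /predU1P[-> //|lS];
      rewrite /A mem_infinity_flat row_dual_span.
  have [e' e'S1] : exists2 e', relation_on S1 e' & \sum_l e' 0 l * x l != 0.
    apply: gx; eexists; first exact: (sumS1 e _ eS jSA).1.
    by apply: contraNneq ej => /rowP/(_ j); rewrite !mxE jQ1 => ->.
  have [_] := sumS1 e' _ e'S1 S1A; rewrite big_mkcond => E /eqP; apply.
  rewrite -[RHS]E; apply: eq_bigr => l _; case: ifP => // /negbT lQ1.
  by rewrite (proj2 e'S1) ?mul0r // inE.
rewrite /A /infinity_flat big_setU1 /=; last by apply/imsetP; case.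
rewrite big_imset /=; last by move=> i j _ _ [].
have -> : \sum_(i in [set j | (row j B <= dual_span B S)%MS]) a i =
    \sum_(i | (row i B <= dual_span B S)%MS) a i by apply: eq_bigl => i;
      rewrite inE.
rewrite (bigID (fun i => row i B <= dual_span B S)%MS xpredT) /=.
by rewrite opprD addrAC addNr add0r oppr_eq0.
Qed.

End Unbalanced.

(** * Derivatives of products of powers of triangular linear forms *)

Section TriangularDerivative.

Variables (K : fieldType) (n : nat) (A : nat -> 'I_n -> K) (b : 'I_n -> nat).
Hypothesis A_tri : forall h j, (h < b j)%N -> A h j = 0.
Implicit Types (N : nat -> nat) (s : seq 'I_n).

Definition linear_form h : {mpoly K[n]} := \sum_j A h j *: 'X_j.

Lemma mderiv_linear_form i h : mderiv i (linear_form h) = (A h i)%:MP.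
Proof.
rewrite /linear_form linear_sum (bigD1 i) //= linearZ /= mderivX mnm1E eqxx
  scale1r.
rewrite big1 ?addr0 => [|j ne].
  rewrite (_ : (U_(i) - U_(i))%MM = 0%MM) ?mpolyX0 ?alg_mpolyC ?mpolyC1
    -?mul_mpolyC ?mulr1 //.
  by apply/mnmP=> l; rewrite mnmBE subnn mnm0E.
by rewrite linearZ /= mderivX mnm1E (negPf ne) scale0r scaler0.
Qed.

Lemma mderivXn i (p : {mpoly K[n]}) e :
  mderiv i (p ^+ e) = e%:R *: (mderiv i p * p ^+ e.-1).
Proof.
elim: e => [|e IHe]; first by rewrite expr0 mderivC scale0r.
rewrite exprS mderivM IHe /= -scalerAr mulrCA -natr1 scalerDl scale1r addrC.
by congr (_ + _); case: e {IHe} => [|e]; rewrite ?scale0r //= exprS.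
Qed.

Definition decr_at N h : nat -> nat := fun x => (N x - (x == h))%N.

Lemma mderiv_prod m N i :
  mderiv i (\prod_(h < m) linear_form h ^+ N h) =
  \sum_(h < m) ((N h)%:R * A h i) *: \prod_(x < m) linear_form x ^+ decr_at N h
    x.
Proof.
elim: m => [|m IHm]; first by rewrite !big_ord0 mderivC.
rewrite !big_ord_recr /= mderivM IHm mulr_suml; congr (_ + _).
  apply: eq_bigr => h _; rewrite -scalerAl big_ord_recr /=;
    congr (_ *: (_ * _ ^+ _)).
  by rewrite /decr_at gtn_eqF // subn0.
rewrite mderivXn mderiv_linear_form mul_mpolyC -!scalerAr scalerA;
  congr (_ *: _).
rewrite /decr_at eqxx subn1; congr (_ * _).
by apply: eq_bigr => h _; rewrite ltn_eqF // subn0.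
Qed.

Lemma iter_mderiv_cons i s (p : {mpoly K[n]}) :
  iter_mderiv (i :: s) p = iter_mderiv s (mderiv i p).
Proof. by elim: s => //= j s <-; rewrite mderiv_comm. Qed.

Lemma iter_mderiv_sum s (T : finType) (F : T -> {mpoly K[n]}) :
  iter_mderiv s (\sum_h F h) = \sum_h iter_mderiv s (F h).
Proof. by elim: s => //= j s ->; rewrite linear_sum. Qed.

Lemma iter_mderivZ s (c : K) (p : {mpoly K[n]}) :
  iter_mderiv s (c *: p) = c *: iter_mderiv s p.
Proof. by elim: s => //= j s ->; rewrite mderivZ. Qed.

Lemma count_lt_sum s r :
  count (fun j => b j < r)%N s = (\sum_(h < r) count (fun j => b j == h) s)%N.
Proof.
elim: s => [|j s IHs] /=; first by rewrite big1.
rewrite IHs big_split /=; congr (_ + _)%N.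
case: ltnP => [lt_r|ge_r]; last first.
  by rewrite big1 // => h _; rewrite gtn_eqF // (leq_trans (ltn_ord h)).
rewrite (bigD1 (Ordinal lt_r)) //= eqxx big1 // => h /eqP ne.
by apply/eqP; rewrite eqb0; apply/eqP => E; apply: ne; apply: val_inj.
Qed.

Lemma sum_decr_at N h r : (0 < N h)%N ->
  (\sum_(x < r) decr_at N h x + (h < r) = \sum_(x < r) N x)%N.
Proof.
move=> Nh; elim: r => [|r IHr]; first by rewrite !big_ord0.
rewrite !big_ord_recr /= -IHr /decr_at ltnS leq_eqVlt.
case: (eqVneq r h) => [->|ne]; last first.
  by rewrite subn0 addnAC.
by rewrite ltnn /= addn0 -addnA subnK.
Qed.

Definition counts m N s :=
  [forall h : 'I_m, count (fun j => b j == h) s == N h].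

Lemma counts_lt m N s r : counts m N s -> (r <= m)%N ->
  count (fun j => b j < r)%N s = (\sum_(h < r) N h)%N.
Proof.
move=> /forallP cN rm; rewrite count_lt_sum; apply: eq_bigr => h _.
exact/eqP/(cN (widen_ord rm h)).
Qed.

(** A derivation in [z_j] can only hit the forms [h] with [b j <= h]. If it
    hits one with [b j < h], the bound on counts implies that the forms up to
    [b j] keep more factors than there are derivations left for them, and the
    result is zero. So every [z_j] has to hit the form [b j]. *)
Lemma iter_mderiv_triangular m N s :
  (forall r, (r <= m)%N -> count (fun j => b j < r)%N s <=
    \sum_(h < r) N h)%N ->
  size s = (\sum_(h < m) N h)%N ->
  iter_mderiv s (\prod_(h < m) linear_form h ^+ N h) =
  ((\prod_(h < m) (N h)`!)%:R * (counts m N s)%:R * \prod_(j <- s) A (b j)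
    j)%:MP.
Proof.
elim: s N => [|j s IHs] N cle szs.
  have N0 (h : 'I_m) : N h = 0%N.
    by apply/eqP; rewrite -leqn0 [X in (_ <= X)%N]szs (bigD1 h) //= leq_addr.
  rewrite /= big_nil big1 => [|h _]; last by rewrite N0.
  rewrite big1 => [|h _]; last by rewrite N0.
  rewrite (_ : counts _ _ _ = true) ?mulr1 ?mpolyC1 //.
  by apply/forallP=> h; rewrite N0.
rewrite iter_mderiv_cons mderiv_prod iter_mderiv_sum.
rewrite (eq_bigr _ (fun h _ => iter_mderivZ s _ _)).
have IH (h : 'I_m) : (b j <= h)%N -> (0 < N h)%N ->
    iter_mderiv s (\prod_(x < m) linear_form x ^+ decr_at N h x) =
    ((\prod_(x < m) (decr_at N h x)`!)%:R * (counts m (decr_at N h) s)%:R *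
      \prod_(j <- s) A (b j) j)%:MP.
  move=> bh Nh; apply: IHs => [r rm|]; last first.
    by move: szs; rewrite -(sum_decr_at m Nh) ltn_ord addn1 => -[].
  have := cle r rm; rewrite -(sum_decr_at r Nh) /=.
  case: (ltnP h r) => hr; first
    by rewrite (leq_ltn_trans bh hr) addnC leq_add2r.
  by rewrite addn0; apply: leq_trans; rewrite leq_addl.
have [ltm|gem] := ltnP (b j) m; last first.
  rewrite big1 => [|h _];
    last by rewrite A_tri ?mulr0 ?scale0r // (leq_trans (ltn_ord h)).
  case: (boolP (counts _ _ _)) => [cN|_]; last by rewrite mulr0 mul0r mpolyC0.
  have /= := counts_lt cN (leqnn m); rewrite -szs ltnNge gem add0n => E.
  by have := count_size (fun i => (b i < m)%N) s; rewrite E ltnn.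
rewrite (bigD1 (Ordinal ltm)) //= [X in _ + X]big1 ?addr0 => [|h ne];
  last first.
  case: (ltngtP h (b j)) => [lt|gt|E]; last by move: ne;
    rewrite -val_eqE /= E eqxx.
    by rewrite A_tri // mulr0 scale0r.
  case: (posnP (N h)) => [->|Nh]; first by rewrite mul0r scale0r.
  rewrite IH ?(ltnW gt) //; case: (boolP (counts _ _ _)) => [cN|_]; last first.
    by rewrite mulr0 mul0r mpolyC0 scaler0.
  have := counts_lt cN (leq_trans gt (ltnW (ltn_ord h))).
  have /= := cle _ (leq_trans gt (ltnW (ltn_ord h))).
  by rewrite -(sum_decr_at _ Nh) ltnS leqnn ltnNge gt addn0 /= => le E;
    rewrite E ltnn in le.
case: (posnP (N (b j))) => [E|Nh].
  rewrite {1}E mul0r scale0r;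
    case: (boolP (counts _ _ _)) => [/forallP/(_ (Ordinal ltm))|_].
    by rewrite /= eqxx E.
  by rewrite mulr0 mul0r mpolyC0.
rewrite (IH (Ordinal ltm)) //= big_cons -mul_mpolyC -mpolyCM; congr (_%:MP).
have -> : counts m N (j :: s) = counts m (decr_at N (b j)) s.
  apply: eq_forallb => h; rewrite /= /decr_at; case: (eqVneq (b j) h) => [<-|_];
    last by rewrite subn0.
  by rewrite add1n -[N (b j)]prednK // eqSS subn1.
rewrite (bigD1 (Ordinal ltm)) //= [X in _ =
  X%:R * _ * _](bigD1 (Ordinal ltm)) //=.
rewrite (eq_bigr (fun h : 'I_m => (N h)`!)) => [|h ne]; last first.
  by rewrite /decr_at (_ : (h == b j :> nat) = false) ?subn0 //; apply: negPf.
rewrite /decr_at eqxx subn1 -[in RHS](prednK Nh) factS prednK //.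
by rewrite !natrM; ring.
Qed.

End TriangularDerivative.

(** * The functional of an elementary subarrangement *)

Section ListMinor.

Variables (K : fieldType) (n k : nat) (C : 'M[K]_(n, k)) (j0 : 'I_n).

(** The rows are given by a list and the size is explicit, so that blocks
    can be concatenated without casts between matrix dimensions. *)
Definition list_minor N (s : seq 'I_n) off : K :=
  \det (\matrix_(l < N, r < N) coord_at C (nth j0 s l) (off + r)).

Lemma list_minor_cat N1 N2 s t off : size s = N1 ->
  (forall j r, j \in s -> (off + N1 <= r)%N -> coord_at C j r = 0) ->
  list_minor (N1 + N2) (s ++ t) off =
    list_minor N1 s off * list_minor N2 t (off + N1).
Proof.
move=> sz C0;
  pose Adl : 'M[K]_(N2, N1) := \matrix_(l, r) coord_at C (nth j0 t l) (off + r).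
rewrite /list_minor -(det_lblock _ Adl); congr (\det _).
apply/matrixP=> i j; rewrite mxE.
case: (split_ordP i) => l ->; case: (split_ordP j) => r ->.
- by rewrite block_mxEul mxE /= nth_cat sz ltn_ord.
- rewrite block_mxEur mxE /= nth_cat sz ltn_ord C0 ?addnA ?leq_addr //.
  by rewrite mem_nth // sz.
- by rewrite block_mxEdl mxE /= nth_cat sz ltnNge leq_addr /= addKn.
- by rewrite block_mxEdr mxE /= nth_cat sz ltnNge leq_addr /= addKn addnA.
Qed.

End ListMinor.

Lemma prod_lift (K : fieldType) N (i0 : 'I_N) (F : 'I_N -> K) :
  \prod_i F i = F i0 * \prod_(l < N.-1) F (lift i0 l).
Proof. by case: N i0 F => [[]|N] // i0 F; rewrite (bigD1_ord i0). Qed.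

Section Elementary.

Variables (K : numFieldType) (n k : nat) (B : 'M[K]_(n, k)).
Variables (Js : seq {set 'I_n}) (elJ : elementary B Js).
Implicit Types (I L : k.-tuple 'I_n) (h r : nat).

(** The value is [size Js] outside of all blocks. *)
Definition block_index (j : 'I_n) : nat :=
  find (fun A : {set 'I_n} => j \in A) Js.

Local Notation m := (size Js).

Lemma block_gt1 h : (h < m)%N -> (1 < #|block Js h|)%N.
Proof. by move=> hm; case/and4P: elJ => /all_nthP al _ _ _; apply: al. Qed.

Lemma part_succ h : (h < m)%N -> (part Js h).+1 = #|block Js h|.
Proof. by move/block_gt1; rewrite /part; case: #|_|. Qed.

Lemma block_disjoint h r j : (h < m)%N -> (r < m)%N ->
  j \in block Js h -> j \in block Js r -> h = r.
Proof.
case/and4P: elJ => _ pw _ _ hm rm jh jr.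
have D x y : (x < y)%N -> (y < m)%N -> j \in block Js x -> j \in block Js y ->
  False.
  move=> xy ym jx jy; have /(pairwiseP set0)/(_ x y) := pw.
  rewrite !inE => /(_ (ltn_trans xy ym) ym xy) /disjointFr/(_ jx).
  by rewrite -[nth _ _ _]/(block Js y) jy.
by case: (ltngtP h r) => // [/D/(_ rm jh jr)|/D/(_ hm jr jh)].
Qed.

Lemma mem_block h j : (h < m)%N -> (j \in block Js h) = (block_index j == h).
Proof.
move=> hm; apply/idP/eqP => [jh|E].
  have hasj : has (fun A : {set 'I_n} => j \in A) Js.
    by apply/(has_nthP set0); exists h.
  apply: (block_disjoint (j := j)) => //; first
    by rewrite /block_index -has_find.
  exact: (nth_find set0 hasj).
have hasj : has (fun A : {set 'I_n} => j \in A) Js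
  by rewrite has_find -/(block_index j) E.
by rewrite -E; exact: (nth_find set0 hasj).
Qed.

Lemma mem_block_union h j : (h <= m)%N ->
  (j \in block_union Js h) = (block_index j < h)%N.
Proof.
move=> hm; apply/bigcupP/idP => [[r _]|lt].
  by rewrite mem_block ?(leq_trans (ltn_ord r)) // => /eqP ->.
by exists (Ordinal lt); rewrite // mem_block ?(leq_trans lt) //=.
Qed.

Lemma rank_block_union h : (h <= m)%N ->
  \rank (dual_span B (block_union Js h)) = part_sum Js h.
Proof.
case: h => [|h] hm.
  rewrite /dual_span big1 ?mxrank0 /part_sum ?big_ord0 // => i.
  by rewrite /block_union big_ord0 inE.
by case/and4P: elJ => _ _ _ /forallP/(_ (Ordinal hm))/andP[/eqP].
Qed.

Lemma rank_block_unionD1 h j : (h < m)%N -> j \in block Js h ->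
  \rank (dual_span B (block_union Js h.+1 :\ j)) = part_sum Js h.+1.
Proof.
move=> hm jh.
by case/and4P:
  elJ => _ _ _ /forallP/(_ (Ordinal hm))/andP[_ /forall_inP/(_ j jh)/eqP].
Qed.

Lemma part_sum_full : part_sum Js m = k.
Proof. by case/and4P: elJ => _ _ /eqP. Qed.

Lemma count_block_index s h : independent B s -> (h <= m)%N ->
  (count (fun j => block_index j < h)%N s <= part_sum Js h)%N.
Proof.
move=> sI hm; rewrite -rank_block_union //.
rewrite (eq_count (a2 := mem (block_union Js h))) ?independent_count // => j.
by rewrite /= mem_block_union.
Qed.

Section Choice.

Variables (c : prepotential_choice K n k) (cJ : valid_choice B Js c).

(** The coefficient of the variable [j] in the [h]-th relation form, and of
    [g_j] in the [h]-th linear relation. *)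
Definition rel_coef h (j : 'I_n) : K :=
  \sum_(i < #|block Js h| | pc_enum c i == j) (-1) ^+ i * block_minor B c i
  + (if j \in block_union Js h then pc_rel c h j else 0).

Lemma relation_formE h : relation_form B Js c h = linear_form rel_coef h.
Proof.
rewrite /linear_form /rel_coef.
under [RHS]eq_bigr => j _ do rewrite scalerDl.
rewrite big_split /=; congr (_ + _).
  under [RHS]eq_bigr => j _ do rewrite scaler_suml.
  rewrite (exchange_big_dep xpredT) //=; apply: eq_bigr => i _.
  by rewrite (big_pred1 (pc_enum c i)) // => j /=; rewrite eq_sym.
rewrite [LHS]big_mkcond; apply: eq_bigr => j _.
by case: ifP => //; rewrite scale0r.
Qed.

Lemma rel_coef_row h : (h < m)%N -> \sum_j rel_coef h j *: row j B = 0.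
Proof.
move=> hm; case: cJ => _ _ _ /(_ h hm) E; rewrite -[RHS]E /rel_coef.
under [LHS]eq_bigr => j _ do rewrite scalerDl.
rewrite big_split /=; congr (_ + _).
  under [LHS]eq_bigr => j _ do rewrite scaler_suml.
  rewrite (exchange_big_dep xpredT) //=; apply: eq_bigr => i _.
  by rewrite (big_pred1 (pc_enum c i)) // => j /=; rewrite eq_sym.
rewrite [RHS]big_mkcond; apply: eq_bigr => j _.
by case: ifP => //; rewrite scale0r.
Qed.

Lemma block_index_pc_enum h (i : 'I_#|block Js h|) : (h < m)%N ->
  block_index (pc_enum c i) = h.
Proof.
by move=> hm; case: cJ => _ _ /(_ h hm)[_ /(_ i)] + _;
  rewrite mem_block // => /eqP.
Qed.

Lemma pc_enum_onto h j : (h < m)%N -> block_index j = h ->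
  exists i : 'I_#|block Js h|, j = pc_enum c i.
Proof.
move=> hm jh; case: cJ => _ _ /(_ h hm)[inj mem] _.
have : [set pc_enum c i | i : 'I_#|block Js h|] = block Js h.
  apply/eqP; rewrite eqEcard card_imset // card_ord leqnn andbT.
  by apply/subsetP=> _ /imsetP[i _ ->]; apply: mem.
move/setP/(_ j); rewrite mem_block // jh eqxx => /imsetP[i _ ->]; by exists i.
Qed.

Lemma rel_coef_tri h j : (h < block_index j)%N -> rel_coef h j = 0.
Proof.
move=> lt; have hm : (h < m)%N by apply: leq_trans lt (find_size _ _).
rewrite /rel_coef mem_block_union ?(ltnW hm) // ltnNge (ltnW lt) addr0
  big1 // => i /eqP E.
by move: lt; rewrite -E block_index_pc_enum // ltnn.
Qed.

Lemma rel_coef_pc_enum h (i : 'I_#|block Js h|) : (h < m)%N ->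
  rel_coef h (pc_enum c i) = (-1) ^+ i * block_minor B c i.
Proof.
move=> hm; rewrite /rel_coef mem_block_union ?(ltnW hm) //
  block_index_pc_enum // ltnn addr0.
by rewrite (big_pred1 i) // => r /=; case: cJ => _ _ /(_ h hm)[/inj_eq -> _].
Qed.

(** For duplicate-free [s] this means that [s] omits exactly one element of
    each block; counting makes the condition additive in [s]. *)
Definition transversal s : bool := counts block_index m (part Js) s.

Lemma transversal_perm s t : perm_eq s t -> transversal s = transversal t.
Proof. by move=> /seq.permP st; apply: eq_forallb => h; rewrite st. Qed.

(** Both [I] and [L] have at most [part_sum Js r] entries in the first [r]
    blocks, so together they have twice as many only if each attains this
    bound. *)
Lemma transversal_cat I L : independent B I -> independent B L ->
  counts block_index m (fun h => 2 * part Js h)%N (I ++ L) =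
    transversal I && transversal L.
Proof.
move=> II LI; apply/idP/andP => [cN|[/forallP cI /forallP cL]]; last first.
  by apply/forallP=> h; rewrite count_cat (eqP (cI h)) (eqP (cL h)) mul2n addnn.
have E r : (r <= m)%N -> count (fun j => block_index j < r)%N I =
  part_sum Js r /\
    count (fun j => block_index j < r)%N L = part_sum Js r.
  move=> rm; have := counts_lt cN rm;
    rewrite count_cat -big_distrr /= -/(part_sum Js r).
  have := count_block_index II rm; have := count_block_index LI rm; lia.
have D s : (forall r, (r <= m)%N -> count (fun j => block_index j < r)%N s =
  part_sum Js r) -> transversal s.
  move=> Es; apply/forallP=> h; have := Es h.+1 (ltn_ord h);
    have := Es h (ltnW (ltn_ord h)).
  rewrite !count_lt_sum /part_sum !big_ord_recr /= => -> /addnI/eqP //.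
by split; apply: D => r /E[].
Qed.

(** Up to the scalar [minors_prod], this is the coordinate at [I] of the wedge
    product, over the blocks, of the boundaries of the simplices [J_h]. *)
Definition elementary_functional I : K :=
  minor B I * (transversal I)%:R * \prod_(j <- I) rel_coef (block_index j) j.

Local Notation phi := elementary_functional.

Definition minors_prod : K :=
  \prod_(h < m) \prod_(i < #|block Js h|) block_minor B c i.

(** The derivative separates into a function of [I] and one of [L], because
    every index is differentiated in the form of its own block. The
    coefficients of a form outside of its own block disappear. *)
Lemma mderiv_prepotential (a : 'I_n -> K) I L :
  (minor B I * minor B L) *: iter_mderiv (I ++ L) (prepotential B a Js c) =
  ((\prod_(h < m) \prod_(j in block Js h) a j) / minors_prod ^+ 2 * phi I * phi
    L)%:MP.
Proof.
rewrite /phi; have [II|dI] := boolP (independent B I); last first.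
  by move: dI; rewrite independent_minor negbK => /eqP ->;
    rewrite !mul0r mulr0 mul0r scale0r mpolyC0.
have [LI|dL] := boolP (independent B L); last first.
  by move: dL; rewrite independent_minor negbK => /eqP ->;
    rewrite !(mul0r, mulr0) scale0r mpolyC0.
rewrite /prepotential scaler_prod iter_mderivZ.
under [X in iter_mderiv _ X]eq_bigr => h _ do rewrite relation_formE.
rewrite (@iter_mderiv_triangular _ _ rel_coef block_index rel_coef_tri m
  (fun h => 2 * part Js h)%N); first last.
- by rewrite size_cat !size_tuple -big_distrr /= -/(part_sum Js m) part_sum_full
    mul2n addnn.
- move=> r rm; rewrite count_cat -big_distrr /= -/(part_sum Js r) mul2n -addnn.
  by rewrite leq_add // count_block_index.
rewrite transversal_cat // -mulnb natrM big_cat /= -!mul_mpolyC -!mpolyCM;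
  congr (_%:MP).
rewrite /minors_prod.
have -> : \prod_(h < m) ((\prod_(j in block Js h) a j) / ((2 * part Js h)`!)%:R
  /
    (\prod_(i < #|block Js h|) block_minor B c i) ^+ 2) =
   (\prod_(h < m) \prod_(j in block Js h) a j) /
     (\prod_(h < m) (2 * part Js h)`!)%:R /
   (\prod_(h < m) \prod_(i < #|block Js h|) block_minor B c i) ^+ 2.
  by rewrite !big_split /= natr_prod !prodfV prodrXl.
have nz : (\prod_(h < m) (2 * part Js h)`!)%:R != 0 :> K.
  by rewrite pnatr_eq0 -lt0n prodn_gt0 // => h; rewrite fact_gt0.
move: nz; move: (_%:R : K) => F nz; move: (_ ^- 2) => D.
by field.
Qed.

Lemma elementary_functional_perm I (p : 'S_k) :
  phi (perm_tuple I p) = (-1) ^+ p * phi I.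
Proof.
rewrite /phi minor_perm (transversal_perm (perm_eq_perm_tuple I p)).
by rewrite (perm_big I (perm_eq_perm_tuple I p)) /= -!mulrA.
Qed.

Lemma elementary_functional_dependent I : ~~ independent B I -> phi I = 0.
Proof. by rewrite independent_minor negbK /phi => /eqP ->; rewrite !mul0r. Qed.

Lemma count_upd (P : pred 'I_n) I q j :
  count P (upd I q j) = (P j + \sum_(l | l != q) P (tnth I l))%N.
Proof.
rewrite count_tuple (bigD1 q) //= tnth_upd eqxx; congr (_ + _)%N.
by apply: eq_bigr => l /negPf ne; rewrite tnth_upd ne.
Qed.

Lemma transversal_lt s : size s = k -> transversal s -> forall j, j \in s ->
  (block_index j < m)%N.
Proof.
move=> sz tr j js; have := counts_lt tr (leqnn m);
  rewrite -/(part_sum Js m) part_sum_full -sz.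
by move/eqP; rewrite -all_count => /allP/(_ j js).
Qed.

(** For the last property: if [upd I q j] is transversal for some [j], it is
    so exactly for the [j] of one block [h]. Insert the [h]-th linear relation
    in the row [q] of the minor. The terms with [j] in an earlier block vanish,
    since they have more entries in the first [h] blocks than the rank of these
    allows. *)
Lemma singular_elementary_functional : singular B phi.
Proof.
split; [exact: elementary_functional_perm|exact:
  elementary_functional_dependent|move=> I q].
have [j0 tj0|notr] := pickP (fun j => transversal (upd I q j)); last first.
  by rewrite big1 // => j _; rewrite /phi notr mulr0 mul0r.
set h := block_index j0.
have hm : (h < m)%N.
  apply: (transversal_lt _ tj0); first by rewrite size_tuple.
  by have := mem_tnth q (upd I q j0); rewrite tnth_upd eqxx.
have tE j : transversal (upd I q j) = (block_index j == h).
  apply/idP/eqP => [tj|E]; last first.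
    by suff -> : transversal (upd I q j) = transversal (upd I q j0) by [];
      apply: eq_forallb => r; rewrite !count_upd E.
  have := forallP tj (Ordinal hm);
    rewrite /= -(eqP (forallP tj0 (Ordinal hm))) /=.
  by rewrite !count_upd eqn_add2r -/h eqxx; case: (eqVneq (block_index j) h).
set R := \prod_(l | l != q) rel_coef (block_index (tnth I l)) (tnth I l).
have pE j : \prod_(x <- upd I q j) rel_coef (block_index x) x =
  rel_coef (block_index j) j * R.
  rewrite big_tuple (bigD1 q) //= tnth_upd eqxx; congr (_ * _).
  by apply: eq_bigr => l /negPf ne; rewrite tnth_upd ne.
have := minor_upd_lin I q (rel_coef_row hm); move/(congr1 (fun x => x * R));
  rewrite mul0r mulr_suml => E.
rewrite -[RHS]E; apply: eq_bigr => j _; rewrite /phi tE pE.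
case: ltngtP => [lt|gt|->]; last by rewrite mulr1 mulrCA mulrA.
  have [ind|] := boolP (independent B (upd I q j)); last first.
    by rewrite independent_minor negbK => /eqP ->; rewrite !(mulr0, mul0r).
  have := count_block_index ind (ltnW hm).
  rewrite -[part_sum _ _](counts_lt tj0 (ltnW hm)) !count_upd -/h ltnn lt.
  by rewrite leq_add2r.
by rewrite (rel_coef_tri gt) !(mulr0, mul0r).
Qed.

Variable (j0 : 'I_n).
Local Notation C := (adapted_coords B c).
Local Notation bi := block_index.
Local Notation D := (block_minor B c).

(** This makes the minors of transversals block triangular. *)
Lemma coord_at_block_union h j r : (h <= m)%N -> j \in block_union Js h ->
  (part_sum Js h <= r)%N -> coord_at C j r = 0.
Proof.
move=> hm jh psr; rewrite /coord_at; case: insubP => //= q _ qr.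
have [d1 /(_ h hm)/eqmxP E _ _] := cJ.
have Su : pc_basis c \in unitmx by rewrite unitmxE d1 unitr1.
have : (row j B <= \sum_(q < k | (q < part_sum Js h)%N) <<row q
  (pc_basis c)>>)%MS.
  by rewrite E; apply: row_dual_span.
move=> le; have : row j B *m col q (invmx (pc_basis c)) = 0.
  apply/eqP; rewrite -sub_kermx (submx_trans le) //; apply/sumsmx_subP=> p lt.
  rewrite genmxE sub_kermx colE mulmxA -row_mul mulmxV // rowE mulmx1.
  rewrite mul_delta_mx_cond (_ : p == q = false) //.
  by apply/eqP => E'; move: lt; rewrite E' qr ltnNge psr.
by move/matrixP/(_ 0 0); rewrite /adapted_coords !mxE => E'; rewrite -[RHS]E';
  apply: eq_bigr => i _; rewrite !mxE.
Qed.

(** If [D i0] is nonzero and [D i] is zero, the [h]-th relation expresses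
    [g_(pc_enum c i0)] without using [g_(pc_enum c i)]. Removing the latter then
    makes the former redundant, so the rank drops, which elementarity forbids. *)
Lemma block_minor_neq0 h (i0 i : 'I_#|block Js h|) : (h < m)%N -> D i0 != 0 ->
  D i != 0.
Proof.
move=> hm D0; case: (eqVneq i i0) => [->//|ne]; apply/eqP => Di.
have [_ _ /(_ h hm)[inj mem] _] := cJ.
pose p := pc_enum c i0; pose q := pc_enum c i.
(* Without q the first h + 1 blocks are spanned by Y, which is too small. *)
pose Y := block_union Js h :|: (block Js h :\ p :\ q).
have pY : (row p B <= dual_span B Y)%MS.
  have := rel_coef_row hm; rewrite (bigD1 p) //= => /eqP; rewrite addr_eq0.
  rewrite /p rel_coef_pc_enum // => /eqP E.
  have nz : (-1) ^+ i0 * D i0 != 0 by rewrite mulf_neq0 ?signr_eq0.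
  rewrite -(eqmx_scale _ nz) E eqmx_opp; apply: summx_sub => j nep.
  case: (ltngtP (bi j) h) => [lt|gt|eq].
  - apply: scalemx_sub; apply: row_dual_span;
      by rewrite inE mem_block_union ?(ltnW hm) // lt.
  - by rewrite (rel_coef_tri gt) scale0r sub0mx.
  case: (eqVneq j q) => [->|neq]; first
    by rewrite /q rel_coef_pc_enum // Di mulr0 scale0r sub0mx.
  apply: scalemx_sub; apply: row_dual_span.
  by rewrite !inE neq nep mem_block // eq eqxx orbT.
have qb : q \in block Js h by exact: mem.
have pb : p \in block Js h by exact: mem.
have pq : p != q by rewrite (inj_eq inj) eq_sym.
have : (dual_span B (block_union Js h.+1 :\ q) <= dual_span B Y)%MS.
  apply: dual_span_sub => j;
    rewrite !inE mem_block_union // ltnS leq_eqVlt => /andP[neq].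
  case: (eqVneq j p) => [-> //|nep] jh; apply: row_dual_span.
  by rewrite !inE neq nep mem_block_union ?mem_block ?(ltnW hm) //= orbC.
move/mxrankS; rewrite rank_block_unionD1 //; apply/negP; rewrite -ltnNge.
have rY : (\rank (dual_span B Y) <= part_sum Js h + #|block Js h :\ p :\ q|)%N.
  rewrite -(rank_block_union (ltnW hm)).
  have : (dual_span B Y <= dual_span B (block_union Js h) + dual_span B
    (block Js h :\ p :\ q))%MS.
    apply: dual_span_sub => j; rewrite inE => /orP[] jY.
      by apply: submx_trans (addsmxSl _ _); apply: row_dual_span.
    by apply: submx_trans (addsmxSr _ _); apply: row_dual_span.
  move/mxrankS/leq_trans; apply; apply: leq_trans (mxrank_adds_leqif _ _) _.
  by rewrite leq_add2l rank_dual_span.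
apply: leq_ltn_trans rY _; rewrite /part_sum big_ord_recr /= ltn_add2l.
have := cardsD1 q (block Js h :\ p); rewrite !inE qb (eq_sym q) pq /= => E1.
by rewrite /part (cardsD1 p (block Js h)) pb E1.
Qed.

(** Let [pc_enum c i0] be the element of the block omitted by [I]. The minor of
    the others is [D i0], and their coefficients are, up to sign, the [D i] with
    [i != i0]. *)
Lemma block_transversal I h : independent B I -> transversal I -> (h < m)%N ->
  exists t e, [/\ size t = part Js h, perm_eq t [seq j <- I | bi j == h],
    list_minor C j0 (part Js h) t (part_sum Js h) != 0 ->
      \prod_(i < #|block Js h|) D i != 0 &
    list_minor C j0 (part Js h) t (part_sum Js h) * \prod_(j <- t) rel_coef h j
      =
      (-1) ^+ e * \prod_(i < #|block Js h|) D i].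
Proof.
move=> II tI hm; have [_ _ /(_ h hm)[inj mem] _] := cJ.
have Iu := independent_uniq II.
pose F := [seq j <- I | bi j == h].
have szF : size F = part Js h by rewrite size_filter;
  exact/eqP/(forallP tI (Ordinal hm)).
have [i0 i0I] : exists i0 : 'I_#|block Js h|, pc_enum c i0 \notin val I.
  apply/existsP; rewrite -negb_forall; apply/negP=> /forallP allI.
  have : (size [seq pc_enum c i | i <- enum 'I_#|block Js h|] <= size F)%N.
    apply: uniq_leq_size; first by rewrite map_inj_uniq ?enum_uniq.
    move=> _ /mapP[i _ ->]; rewrite mem_filter block_index_pc_enum // eqxx /=.
    exact: allI.
  by rewrite size_map size_enum_ord szF -(part_succ hm) ltnn.
pose t := [seq pc_enum c (lift i0 l) | l <- enum 'I_(part Js h)].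
have szt : size t = part Js h by rewrite size_map size_enum_ord.
have tF : perm_eq t F.
  have Fu : uniq F by apply: filter_uniq.
  have sub : {subset F <= t}.
    move=> j; rewrite mem_filter => /andP[/eqP bj jI].
    have [i E] := pc_enum_onto hm bj; subst j.
    case: (unliftP i0 i) => [l El|E]; last by move: i0I; rewrite -E jI.
    by rewrite El; apply: map_f; rewrite mem_enum.
  have [_ Ft] := uniq_min_size Fu sub (eq_leq (etrans szt (esym szF))).
  apply: uniq_perm; [|by []|by move=> j; rewrite Ft].
  by rewrite map_inj_uniq ?enum_uniq // => x y /inj/lift_inj.
have lmt : list_minor C j0 (part Js h) t (part_sum Js h) = D i0.
  rewrite /list_minor /block_minor -det_tr; congr (\det _); apply/matrixP=> x y.
  rewrite !mxE (nth_map y) ?size_enum_ord //.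
  by congr (coord_at _ (pc_enum c (lift i0 _)) _); rewrite nth_ord_enum.
exists t, (\sum_(l < part Js h) lift i0 l)%N; split=> //.
  rewrite lmt => D0; apply/prodf_neq0=> i _; exact: block_minor_neq0 D0.
rewrite lmt big_map big_enum /=.
under eq_bigr => l _ do rewrite rel_coef_pc_enum //.
by rewrite big_split /= expr_sum mulrCA -(prod_lift i0 (fun i => D i)).
Qed.

(** Listing the entries of [I] block by block makes the minor block
    triangular. *)
Lemma union_transversal I r : independent B I -> transversal I -> (r <= m)%N ->
  exists s e, [/\ size s = part_sum Js r, perm_eq s [seq j <- I | (bi j < r)%N],
    list_minor C j0 (part_sum Js r) s 0 != 0 ->
      \prod_(h < r) \prod_(i < #|block Js h|) D i != 0 &
    list_minor C j0 (part_sum Js r) s 0 * \prod_(j <- s) rel_coef (bi j) j =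
      (-1) ^+ e * \prod_(h < r) \prod_(i < #|block Js h|) D i].
Proof.
move=> II tI; elim: r => [|r IHr] rm.
  exists [::], 0%N; split; first by rewrite /part_sum big_ord0.
  - by rewrite (eq_filter (a2 := pred0)) ?filter_pred0.
  - by rewrite big_ord0 oner_neq0.
  by rewrite /part_sum !big_ord0 big_nil /list_minor det_mx00.
have [s [e [szs ps nzs Es]]] := IHr (ltnW rm).
have [t [e' [szt pt nzt Et]]] := block_transversal II tI rm.
have ms j : j \in s -> (bi j < r)%N
  by rewrite (perm_mem ps) mem_filter => /andP[].
have mt j : j \in t -> bi j = r
  by rewrite (perm_mem pt) mem_filter => /andP[/eqP].
have pr : part_sum Js r.+1 = (part_sum Js r + part Js r)%N
  by rewrite /part_sum big_ord_recr.
have lm : list_minor C j0 (part_sum Js r.+1) (s ++ t) 0 =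
  list_minor C j0 (part_sum Js r) s 0 * list_minor C j0 (part Js r) t
    (part_sum Js r).
  rewrite pr (list_minor_cat (C := C)) // => j q /ms js; rewrite add0n.
  apply: coord_at_block_union; first exact: ltnW.
  by rewrite mem_block_union // ltnW.
exists (s ++ t), (e + e')%N; split.
- by rewrite size_cat szs szt pr.
- apply: perm_trans (perm_cat ps pt) _; apply/seq.permP=> P.
  rewrite count_cat !count_filter -count_predUI
    [X in (_ + X)%N](eq_count (a2 := pred0)) => [|j /=].
    rewrite count_pred0 addn0; apply: eq_count => j /=.
    by rewrite -andb_orr [in RHS]ltnS [in RHS]leq_eqVlt orbC.
  by rewrite andbACA; case: ltngtP; rewrite !andbF.
- by rewrite lm mulf_eq0 negb_or big_ord_recr /= => /andP[/nzs ? /nzt ?];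
    rewrite mulf_neq0.
rewrite lm big_cat big_ord_recr /= mulrACA Es [X in _ * (_ * X)](_ : _ =
  \prod_(j <- t) rel_coef r j).
  by rewrite Et exprD mulrACA.
by apply: eq_big_seq => j /mt ->.
Qed.

(** Divided by [minors_prod], the functional is [1] or [-1] on independent
    transversals. *)
Lemma functional_normalization I : independent B I -> transversal I ->
  elementary_functional I ^+ 2 = minors_prod ^+ 2 /\ minors_prod != 0.
Proof.
move=> II tI; have [s [e [szs ps nzs Es]]] := union_transversal II tI (leqnn m).
have sI : perm_eq s I.
  apply: (perm_trans ps);
    rewrite (eq_in_filter (a2 := predT)) ?filter_predT // => j jI.
  by rewrite (transversal_lt _ tI) // size_tuple.
move: szs nzs Es; rewrite part_sum_full // => szs nzs Es.
pose S := @Tuple k _ s (introT eqP szs).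
have [p ES] : exists p, S = perm_tuple I p by exact: perm_eq_perm_tupleP.
have [d1 _ _ _] := cJ.
have Su : pc_basis c \in unitmx by rewrite unitmxE d1 unitr1.
have lmS : list_minor C j0 k s 0 = minor B S.
  rewrite minorE -[RHS]mulr1 -[X in _ * X]invr1 -d1 -det_inv -det_mulmx.
  rewrite mul_rowsub_mx -/(adapted_coords B c) /list_minor; congr (\det _).
  apply/matrixP=> x y; rewrite [LHS]mxE [RHS]mxE (tnth_nth j0) /coord_at add0n.
  by rewrite valK.
have tS : transversal S by rewrite (transversal_perm (t := I)).
have nzS : list_minor C j0 k s 0 != 0.
  by rewrite lmS -independent_minor ES
    (independent_perm B (perm_eq_perm_tuple I p)).
split; last exact: nzs.
have -> : elementary_functional I ^+ 2 = elementary_functional S ^+ 2.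
  by rewrite ES elementary_functional_perm // [RHS]exprMn sqrr_sign mul1r.
by rewrite {1}/elementary_functional tS mulr1 -lmS Es exprMn sqrr_sign mul1r.
Qed.

End Choice.
End Elementary.

(** * Elementary subarrangements as chains of blocks *)

Section Chains.

Variables (K : fieldType) (n k : nat) (B : 'M[K]_(n, k)).
Implicit Types (Js : seq {set 'I_n}) (A : {set 'I_n}).

Definition total_union Js := block_union Js (size Js).
Definition total_part Js := part_sum Js (size Js).

Lemma block_union_take Js h : (h <= size Js)%N ->
  total_union (take h Js) = block_union Js h.
Proof.
move=> hs; rewrite /total_union size_take_min (minn_idPl hs).
by apply: eq_bigr => r _; rewrite /block nth_take.
Qed.

Lemma part_sum_take Js h : (h <= size Js)%N ->
  total_part (take h Js) = part_sum Js h.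
Proof.
move=> hs; rewrite /total_part size_take_min (minn_idPl hs).
by apply: eq_bigr => r _; rewrite /part /block nth_take.
Qed.

Lemma total_union_rcons Js A : total_union (rcons Js A) = total_union Js :|: A.
Proof.
rewrite /total_union size_rcons /block_union big_ord_recr /= /block nth_rcons
  ltnn eqxx.
by congr (_ :|: _); apply: eq_bigr => r _; rewrite nth_rcons ltn_ord.
Qed.

Lemma total_part_rcons Js A :
  total_part (rcons Js A) = (total_part Js + #|A|.-1)%N.
Proof.
rewrite /total_part size_rcons /part_sum big_ord_recr /= /part /block nth_rcons
  ltnn eqxx.
by congr (_ + _)%N; apply: eq_bigr => r _; rewrite nth_rcons ltn_ord.
Qed.

(** The conditions on one block of an elementary subarrangement, given the
    previous blocks. *)
Definition extends Js A : bool :=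
  [&& (1 < #|A|)%N, [disjoint A & total_union Js],
      \rank (dual_span B (total_union Js :|: A)) == (total_part Js + #|A|.-1)%N
        &
      [forall j in A, \rank (dual_span B ((total_union Js :|: A) :\ j)) ==
        (total_part Js + #|A|.-1)%N]].

Definition chain Js : bool :=
  [forall h : 'I_(size Js), extends (take h Js) (block Js h)].

Lemma elementaryE Js : elementary B Js = chain Js && (total_part Js == k).
Proof.
have U h : (h < size Js)%N -> block_union Js h.+1 =
  block_union Js h :|: block Js h.
  by move=> _; rewrite /block_union big_ord_recr.
have P h : part_sum Js h.+1 = (part_sum Js h + #|block Js h|.-1)%N.
  by rewrite /part_sum big_ord_recr.
apply/and4P/andP => [[al pw -> /forallP rk]|[/forallP ch ->]].
  split=> //; apply/forallP=> h; have hs := ltn_ord h.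
  rewrite /extends block_union_take ?part_sum_take ?(ltnW hs) // -U // -P.
  have /andP[-> ->] := rk h; rewrite !andbT; apply/andP; split.
    by move/all_nthP: al => /(_ set0 h hs).
  rewrite disjoint_sym; apply/pred0P=> j /=;
    apply/negbTE/negP=> /andP[/bigcupP[r _ jr] jh].
  have /(pairwiseP set0)/(_ r h) := pw.
  rewrite !inE => /(_ (ltn_trans (ltn_ord r) hs) hs (ltn_ord r))
    /disjointFr/(_ jr).
  by rewrite -[nth _ _ _]/(block Js h) jh.
have ext h : (h < size Js)%N -> extends (take h Js) (block Js h).
  by move=> hs; exact: (ch (Ordinal hs)).
split=> //.
- by apply/(all_nthP set0)=> h /ext/and4P[].
- apply/(pairwiseP set0)=> r h; rewrite !inE => rs hs rh.
  have /and4P[_ dj _ _] := ext h hs.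
  rewrite disjoint_sym; apply: disjointWr dj.
  rewrite block_union_take ?(ltnW hs) //.
  exact: (bigcup_sup (Ordinal rh)).
apply/forallP=> h; have /and4P[_ _] := ch h; have hs := ltn_ord h.
by rewrite block_union_take ?part_sum_take ?(ltnW hs) // -U // -P => -> ->.
Qed.

Lemma extends_cat pre A r : elementary B (pre ++ A :: r) -> extends pre A.
Proof.
rewrite elementaryE => /andP[/forallP ch _].
have hs : (size pre < size (pre ++ A :: r))%N
  by rewrite size_cat /= addnS ltnS leq_addr.
by have := ch (Ordinal hs);
  rewrite /= take_size_cat // /block nth_cat ltnn subnn.
Qed.

Lemma chain_rcons pre A : chain pre -> extends pre A -> chain (rcons pre A).
Proof.
move=> /forallP ch ex; apply/forallP=> h; have := ltn_ord h;
  move: (nat_of_ord h) => {}h.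
rewrite [X in (_ < X)%N]size_rcons ltnS leq_eqVlt; case/predU1P=> [->|lt].
  by rewrite -cats1 take_size_cat // /block nth_cat ltnn subnn.
rewrite -cats1 takel_cat ?(ltnW lt) // /block nth_cat lt.
exact: (ch (Ordinal lt)).
Qed.

Lemma total_part_cat pre r : (total_part pre <= total_part (pre ++ r))%N.
Proof.
rewrite /total_part /part_sum size_cat big_split_ord /=.
apply: leq_trans (leq_addr _ _); apply: leq_sum => h _.
by rewrite /part /block nth_cat ltn_ord.
Qed.

Lemma total_part_extends pre A r : extends pre A ->
  (total_part pre < total_part (pre ++ A :: r))%N.
Proof.
case/and4P=> A1 _ _ _; rewrite -cat_rcons;
  apply: leq_trans (total_part_cat _ _).
by rewrite total_part_rcons -addn1 leq_add2l; case: #|A| A1 => [|[]].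
Qed.

End Chains.

Section SumSeqs.

Variables (K : nmodType) (T : finType).
Implicit Types (F : seq T -> K).

Definition sum_seqs M F := \sum_(m < M.+1) \sum_(s : m.-tuple T) F s.

Lemma sum_tuple0 F : \sum_(s : 0.-tuple T) F s = F [::].
Proof.
by rewrite (big_pred1 [tuple]) // => s; apply/esym/eqP; exact: tuple0.
Qed.

Lemma sum_tupleS m F : \sum_(s : m.+1.-tuple T) F s = \sum_A \sum_(s :
  m.-tuple T) F (A :: s).
Proof.
rewrite pair_big /=
  (reindex (fun p : T * m.-tuple T => [tuple of p.1 :: p.2])) //=.
exists (fun t => (thead t, [tuple of behead t])) => [[A s] _|t _] /=.
  by rewrite theadE; congr (_, _); apply: val_inj.
by rewrite -tuple_eta.
Qed.

Lemma sum_seqs0 F : sum_seqs 0 F = F [::].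
Proof. by rewrite /sum_seqs big_ord1 sum_tuple0. Qed.

Lemma sum_seqsS M F :
  sum_seqs M.+1 F = F [::] + \sum_A sum_seqs M (fun s => F (A :: s)).
Proof.
rewrite /sum_seqs big_ord_recl sum_tuple0 exchange_big /=; congr (_ + _).
by apply: eq_bigr => m _; rewrite sum_tupleS.
Qed.

Lemma eq_sum_seqs M F G : F =1 G -> sum_seqs M F = sum_seqs M G.
Proof. by move=> FG; apply: eq_bigr => m _; apply: eq_bigr => s _. Qed.

Lemma sum_seqs_nil M F : (forall A s, F (A :: s) = 0) -> sum_seqs M F = F [::].
Proof.
case: M => [|M] F0; first exact: sum_seqs0.
rewrite sum_seqsS big1 ?addr0 // => A _; rewrite /sum_seqs big1 // => m _;
  rewrite big1 //.
Qed.

End SumSeqs.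

(** * Blocks relative to a basis *)

Section Basis.

Variables (K : numFieldType) (n k : nat) (B : 'M[K]_(n, k)).
Variables (I : k.-tuple 'I_n) (II : independent B I).
Implicit Types (L : k.-tuple 'I_n) (U : {set 'I_k}) (l q : 'I_k) (j p : 'I_n).

Local Notation basis_mx := (rowsub (tnth I) B).

Definition basis_coord j : 'rV[K]_k := row j B *m invmx basis_mx.
Definition supp j : {set 'I_k} := [set l | basis_coord j 0 l != 0].

Lemma basis_mx_unit : basis_mx \in unitmx.
Proof. by move: II; rewrite independent_minor minorE -unitfE -unitmxE. Qed.

Lemma supp_tnth l : supp (tnth I l) = [set l].
Proof.
apply/setP=> q;
  rewrite !inE /basis_coord -row_rowsub -row_mul mulmxV ?basis_mx_unit //.
by rewrite !mxE pnatr_eq0 eqb0 negbK eq_sym.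
Qed.

Lemma row_expand j : row j B = \sum_l basis_coord j 0 l *: row (tnth I l) B.
Proof.
rewrite -[LHS](mulmxKV basis_mx_unit) -/(basis_coord j) mulmx_sum_row.
by apply: eq_bigr => l _; rewrite row_rowsub.
Qed.

Definition basis_span U : 'M[K]_k := dual_span B [set tnth I l | l in U].

Lemma row_basis_span j U : (row j B <= basis_span U)%MS = (supp j \subset U).
Proof.
apply/idP/idP => [le|/subsetP sU].
  apply/subsetP=> q; rewrite inE; apply: contraNT => qU.
  have coordE i : (row i B *m col q (invmx basis_mx)) 0 0 = basis_coord i 0 q.
    by rewrite colE mulmxA -colE mxE.
  rewrite -coordE (row_dual_span_mul _ le) ?mxE // => _ /imsetP[l lU ->].
  apply/matrixP=> x y; rewrite !ord1 coordE [RHS]mxE; apply/eqP.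
  have : q \notin supp (tnth I l) by rewrite supp_tnth inE;
    apply: contraNneq qU => ->.
  by rewrite inE negbK.
rewrite row_expand; apply: summx_sub => l _.
have [/sU lU|] := boolP (l \in supp j).
  by apply: scalemx_sub; apply: row_dual_span; apply: imset_f.
by rewrite inE negbK => /eqP ->; rewrite scale0r sub0mx.
Qed.

Lemma rank_basis_span U : \rank (basis_span U) = #|U|.
Proof.
have Iinj : injective (tnth I) by apply/tuple_uniqP; exact: independent_uniq II.
have cU : #|[set tnth I l | l in U]| = #|U| by rewrite card_imset.
apply/eqP; rewrite eqn_leq -{1}cU rank_dual_span /=.
have := independent_count [set tnth I l | l in U] II; apply: leq_trans.
rewrite count_tuple -sum1_card big_mkcond /=; apply: leq_sum => l _.
by rewrite mem_imset //; case: (l \in U).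
Qed.

Lemma missing_dependent L q : (forall l, q \notin supp (tnth L l)) ->
  ~~ independent B L.
Proof.
move=> miss; rewrite independent_minor negbK minorE.
rewrite -(mulmxKV basis_mx_unit (rowsub (tnth L) B)) det_mulmx.
rewrite (expand_det_col _ q) big1 ?mul0r // => l _.
rewrite [X in X * _](_ : _ = basis_coord (tnth L l) 0 q).
  by have := miss l; rewrite inE negbK => /eqP ->; rewrite mul0r.
by rewrite /basis_coord -(row_rowsub (tnth L)) -row_mul [RHS]mxE.
Qed.

(** [U] is the set of positions of the entries of [I] in the blocks [pre], and
    the union of these blocks has the span of [U] and contains no coloop. *)
Definition adapted (pre : seq {set 'I_n}) U : Prop :=
  [/\ forall j, j \in total_union pre -> supp j \subset U,
      forall l, (tnth I l \in total_union pre) = (l \in U),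
      total_part pre = #|U| &
      forall j, j \in total_union pre ->
        (row j B <= dual_span B (total_union pre :\ j))%MS].

Lemma adapted_nil : adapted [::] set0.
Proof.
have E : total_union [::] = set0 :> {set 'I_n}
  by rewrite /total_union /block_union big_ord0.
split=> [j|l||j]; rewrite ?E ?inE //.
by rewrite /total_part /part_sum big_ord0 cards0.
Qed.

Lemma adapted_span pre U : adapted pre U ->
  (dual_span B (total_union pre) :=: basis_span U)%MS.
Proof.
case=> sU tU _ _; apply/eqmxP/andP; split.
  by apply: dual_span_sub => j /sU; rewrite row_basis_span.
by apply: dual_spanS; apply/subsetP=> _ /imsetP[l lU ->]; rewrite tU.
Qed.

Definition next_block U p : {set 'I_n} :=
  p |: [set tnth I l | l in supp p :\: U].

Lemma tnth_inj : injective (tnth I).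
Proof. by apply/tuple_uniqP; exact: independent_uniq II. Qed.

Lemma mem_next_block U p l : p \notin val I ->
  (tnth I l \in next_block U p) = (l \in supp p :\: U).
Proof.
move=> pI; rewrite in_setU1 mem_imset; last exact: tnth_inj.
by case: eqP => // E; rewrite -E mem_tnth in pI.
Qed.

Lemma next_block_out U p : p \notin val I -> next_block U p :\: [set j in I] =
  [set p].
Proof.
move=> pI; apply/setP=> j; rewrite !inE; case: (eqVneq j p) => [->|ne] /=; first
  by rewrite pI.
by apply/negP=> /andP[+ /imsetP[l _ E]]; rewrite E mem_tnth.
Qed.

Lemma next_block_card U p : p \notin val I ->
  #|next_block U p|.-1 = #|supp p :\: U|.
Proof.
move=> pI; rewrite cardsU1 card_imset; last exact: tnth_inj.
case: imsetP => //= [[l _ E]]; by rewrite E mem_tnth in pI.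
Qed.

(** If [l] is in [supp p], then [g_p] can replace the [l]-th basis vector: this
    is why removing any one element of the new block preserves the span. *)
Lemma extends_next_block pre U p : adapted pre U -> p \notin val I ->
  ~~ (supp p \subset U) ->
  extends B pre (next_block U p) /\ adapted (rcons pre (next_block U p))
    (U :|: supp p).
Proof.
move=> ad pI pU; have [sU tU cU nc] := ad.
set A := next_block U p; set V := U :|: supp p.
have cV : #|V| = (total_part pre + #|A|.-1)%N.
  rewrite next_block_card // cU -cardsUI (_ : U :&: (supp p :\: U) =
    set0) ?cards0 ?addn0.
    by congr #|pred_of_set _|; apply/setP=> l; rewrite !inE; case: (l \in U).
  by apply/setP=> l; rewrite !inE; case: (l \in U).
have sV j : j \in total_union pre :|: A -> supp j \subset V.
  rewrite !inE => /or3P[/sU h|/eqP ->|/imsetP[l + ->]].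
  - exact: subset_trans h (subsetUl _ _).
  - exact: subsetUr.
  by rewrite supp_tnth sub1set !inE => /andP[_ ->]; rewrite orbT.
have tV l : (tnth I l \in total_union pre :|: A) = (l \in V).
  by rewrite in_setU tU mem_next_block // !inE; case: (l \in U).
have le1 (X : {set 'I_n}) : X \subset total_union pre :|: A ->
  (dual_span B X <= basis_span V)%MS.
  by move=> /subsetP XA; apply: dual_span_sub => j /XA/sV;
    rewrite row_basis_span.
have ge1 j : j \in A ->
  (basis_span V <= dual_span B ((total_union pre :|: A) :\ j))%MS.
  move=> jA; apply: dual_span_sub => _ /imsetP[l lV ->].
  case: (eqVneq (tnth I l) j) => [E|ne]; last first.
    by apply: row_dual_span; rewrite in_setD1 ne tV.
  have lp : l \in supp p :\: U by rewrite -(mem_next_block _ _ pI) E.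
  have clp : basis_coord p 0 l != 0 by move: lp; rewrite !inE => /andP[].
  have E2 : basis_coord p 0 l *: row (tnth I l) B =
      row p B - \sum_(q | q != l) basis_coord p 0 q *: row (tnth I q) B.
    by rewrite [in RHS]row_expand (bigD1 l) //= addrK.
  rewrite -(eqmx_scale _ clp) E2; apply: addmx_sub.
    apply: row_dual_span; rewrite !inE eqxx orbT andbT.
    by apply: contraNneq pI => ->; rewrite -E mem_tnth.
  rewrite eqmx_opp; apply: summx_sub => q nq.
  have [qp|] := boolP (q \in supp p).
    apply: scalemx_sub; apply: row_dual_span; rewrite in_setD1 tV !inE orbC.
    by move: qp; rewrite inE => ->; rewrite -E (inj_eq tnth_inj) nq.
  by rewrite inE negbK => /eqP ->; rewrite scale0r sub0mx.
have rk j : j \in A -> \rank (dual_span B ((total_union pre :|: A) :\ j)) =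
  #|V|.
  move=> jA; rewrite -rank_basis_span; apply/eqP;
    rewrite eqn_leq !mxrankS ?ge1 //.
  by apply: le1; apply: subD1set.
have pA : p \in A by rewrite !inE eqxx.
split.
  apply/and4P; split.
  - have : (0 < #|A|.-1)%N by rewrite next_block_card // card_gt0 setD_eq0.
    by case: #|A| => [|[]].
  - rewrite disjoint_sym; apply/pred0P=> j /=; apply/negbTE/negP=> /andP[jU].
    rewrite !inE => /predU1P[E|/imsetP[l + E]]; first by case/negP: pU;
      apply: sU; rewrite -E.
    by move: jU; rewrite E tU inE => ->.
  - rewrite -cV -rank_basis_span eqn_leq mxrankS ?le1 //= mxrankS //.
    by apply: submx_trans (ge1 p pA) _; apply: dual_spanS; apply: subD1set.
  by apply/forall_inP=> j jA; rewrite rk // cV.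
split; rewrite ?total_union_rcons //; first by rewrite total_part_rcons -cV.
move=> j; rewrite in_setU => /orP[jU|jA]; last first.
  by apply: submx_trans (ge1 j jA);
    rewrite row_basis_span sV // in_setU jA orbT.
apply: submx_trans (nc j jU) _; apply: dual_spanS; apply: setSD;
  exact: subsetUl.
Qed.

(** Let [D] be the set of positions of [I] in [A]. The rank condition on all of
    [A] forces [supp p] into [U :|: D], and the rank condition after removal of
    the element at a position in [D] forces this position into [supp p]. *)
Lemma extends_only_next_block pre U A : adapted pre U -> extends B pre A ->
  #|A :\: [set j in I]| = 1%N ->
  exists p, [/\ p \notin val I, ~~ (supp p \subset U) & A = next_block U p].
Proof.
move=> ad ex /eqP/cards1P[p AIp]; have [sU tU cU _] := ad.
case/and4P: ex => A1 dis /eqP rkA /forall_inP rkD.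
have : p \in A :\: [set j in I] by rewrite AIp set11.
rewrite !inE => /andP[pI pA].
pose D := [set l | tnth I l \in A].
have AE : A = p |: [set tnth I l | l in D].
  apply/setP=> j; rewrite in_setU1; apply/idP/idP => [jA|].
    case: eqP => //= ne; have [/tnthP[l E]|jI] := boolP (j \in val I).
      by rewrite E imset_f // inE -E.
    have : j \in A :\: [set j in I] by rewrite !inE jI.
    by rewrite AIp inE => /eqP.
  by case/predU1P=> [->//|/imsetP[l + ->]]; rewrite inE.
have DU l : l \in D -> l \notin U.
  by rewrite inE => lA; rewrite -tU; rewrite (disjointFr dis lA).
have cA : #|A|.-1 = #|D|.
  rewrite AE cardsU1 card_imset; last exact: tnth_inj.
  by case: imsetP => //= [[l _ E]]; rewrite E mem_tnth in pI.
have cUD : #|U :|: D| = (total_part pre + #|A|.-1)%N.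
  rewrite cA cU -cardsUI (_ : U :&: D = set0) ?cards0 ?addn0 //.
  by apply/setP=> l; rewrite !inE; apply/negP=> /andP[lU lA]; move: (DU l);
    rewrite inE lA lU => /(_ isT).
have pUD : supp p \subset U :|: D.
  rewrite -row_basis_span.
  have le : (basis_span (U :|: D) <= dual_span B (total_union pre :|: A))%MS.
    apply: dual_spanS; apply/subsetP=> _ /imsetP[l + ->].
    by rewrite !inE tU.
  have [_] := mxrank_leqif_sup le;
    rewrite rank_basis_span rkA cUD eqxx => /esym ge.
  by apply: submx_trans ge; apply: row_dual_span; rewrite inE pA orbT.
have Dp l : l \in D -> l \in supp p.
  move=> lD; have := rkD _ (_ : tnth I l \in A); rewrite -cUD.
  move=> /(_ _)/eqP rk; apply: contraT => lp.
  have : (dual_span B ((total_union pre :|: A) :\ tnth I l) <=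
    basis_span ((U :|: D) :\ l))%MS.
    apply: dual_span_sub => j; rewrite in_setD1 in_setU AE => /andP[ne].
    rewrite row_basis_span in_setU1 => /or3P[/sU jU|/eqP ->|/imsetP[q qD E]].
    - apply/subsetP=> q /(subsetP jU) qU; rewrite in_setD1 in_setU qU andbT.
      by apply: contraNneq (DU l lD) => <-.
    - by rewrite subsetD1 pUD lp.
    rewrite E supp_tnth sub1set in_setD1 in_setU qD orbT andbT.
    by apply: contraNneq ne => <-; rewrite E.
  move/mxrankS; rewrite rk ?rank_basis_span; last by move: lD; rewrite inE.
  by rewrite (cardsD1 l (U :|: D)) in_setU lD orbT ltnn.
have DE : D = supp p :\: U.
  apply/setP=> l; rewrite in_setD; apply/idP/andP => [lD|[lU lp]]; first
    by rewrite DU ?Dp.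
  by have := subsetP pUD l lp; rewrite in_setU (negPf lU).
exists p; split; [by []| |by rewrite AE DE].
rewrite -setD_eq0 -DE -card_gt0 -cA; by case: #|A| A1 => [|[]].
Qed.

End Basis.

(** * The sum over all chains telescopes *)

Section Telescoping.

Variables (K : numFieldType) (n k : nat) (B : 'M[K]_(n, k)) (a : 'I_n -> K).
Variables (I : k.-tuple 'I_n) (II : independent B I).
Implicit Types (L : k.-tuple 'I_n) (U : {set 'I_k}) (l q : 'I_k) (j p : 'I_n).

Local Notation T := [set j in I].
Local Notation supp := (supp B I).

Definition flat_weight (X : {set 'I_n}) : K :=
  \sum_(i | ~~ (row i B <= dual_span B X)%MS) a i.

Hypothesis flat_weight_neq0 : forall X : {set 'I_n},
  (forall j, j \in X -> (row j B <= dual_span B (X :\ j))%MS) ->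
  (\rank (dual_span B X) < k)%N -> flat_weight X != 0.

Variables (psi : k.-tuple 'I_n -> K) (psi_sing : singular B psi).

(** Every block [A] leaves the choice of its element to be omitted: either the
    element [p] outside of [I], or an entry of [I], which [p] replaces in [L] at
    the cost of a sign. The choice is weighted by the weight of the omitted
    element. *)
Fixpoint exchange_sum (r : seq {set 'I_n}) L : K :=
  if r is A :: r' then
    \sum_(p in A :\: T) (a p * exchange_sum r' L -
       \sum_(q | tnth I q \in A) a (tnth I q) * exchange_sum r' (upd L q p))
  else psi L.

Definition weights (pre r : seq {set 'I_n}) : K :=
  \prod_(h < size r) flat_weight (block_union (pre ++ r) (size pre + h)).

Lemma weights_cons pre A r :
  weights pre (A :: r) = flat_weight (total_union pre) * weights (rcons pre A)
    r.
Proof.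
rewrite /weights big_ord_recl addn0 /=; congr (flat_weight _ * _).
  rewrite /total_union /block_union; apply: eq_bigr => h _.
  by rewrite /block nth_cat ltn_ord.
apply: eq_bigr => h _; rewrite cat_rcons size_rcons;
  congr (flat_weight (block_union _ _)).
by rewrite addSn addnS.
Qed.

Definition exchange_summand pre L r : K :=
  if elementary B (pre ++ r) && all (fun A : {set 'I_n} => #|A :\: T| == 1%N) r
  then (weights pre r)^-1 * exchange_sum r L else 0.

Lemma singular_upd_eq0 L q p : q \notin supp p ->
  (forall l, l != q -> q \notin supp (tnth L l)) -> psi (upd L q p) = 0.
Proof.
move=> qp qL; have [_ psi0 _] := psi_sing; apply: psi0.
apply: (missing_dependent II (q := q)) => l; rewrite tnth_upd.
by case: eqP => // /eqP ne; apply: qL.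
Qed.

(** The values [psi (upd L q p)] add up to zero over all [p]. They vanish unless
    [q] is in [supp p], so besides [psi L] only the [p] outside of [I] with [q] in
    [supp p] contribute, and the exchanges at [q] add up to [- psi L]. The total
    collects [a_p] from every [p] outside of [I] with support not in [U], and
    [a_j] from every entry [j] of [I] at a position outside of [U]. *)
Lemma exchange_step pre U L :
  adapted B I pre U ->
  (forall l, l \notin U -> tnth L l = tnth I l) ->
  (forall l, l \in U -> supp (tnth L l) \subset U) ->
  \sum_(p | (p \notin val I) && ~~ (supp p \subset U))
     (a p * psi L - \sum_(q in supp p :\: U) a (tnth I q) * psi (upd L q p)) =
  flat_weight (total_union pre) * psi L.
Proof.
move=> ad LI LU.
have Lq q l : q \notin U -> l != q -> q \notin supp (tnth L l).
  move=> qU nl; have [lU|lU] := boolP (l \in U).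
    by apply: contra qU; apply: (subsetP (LU l lU)).
  by rewrite LI // supp_tnth // inE eq_sym.
have swap q : q \notin U ->
    \sum_(p | (p \notin val I) && (q \in supp p)) psi (upd L q p) = - psi L.
  move=> qU; have [_ _ /(_ L q)] := psi_sing.
  rewrite (bigID (fun p => q \in supp p)) /= [X in _ + X]big1 ?addr0 => [|p qp];
    last first.
    by apply: singular_upd_eq0 => // l; apply: Lq.
  rewrite (bigID (fun p => p \in val I)) /= (big_pred1 (tnth I q)) => [|p /=];
    last first.
    apply/andP/eqP => [[qp /tnthP[l E]]|->];
      last by rewrite supp_tnth // set11 mem_tnth.
    by move: qp; rewrite E supp_tnth // inE => /eqP ->.
  rewrite -(LI q qU) upd_id => /eqP; rewrite addrC addr_eq0 => /eqP <-.
  by apply: eq_bigl => p; rewrite andbC.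
rewrite sumrB -mulr_suml.
have -> : \sum_(p | (p \notin val I) && ~~ (supp p \subset U))
    \sum_(q in supp p :\: U) a (tnth I q) * psi (upd L q p) =
    - ((\sum_(q | q \notin U) a (tnth I q)) * psi L).
  rewrite (exchange_big_dep (fun q => q \notin U)) /=; last first.
    by move=> p q _; rewrite inE => /andP[].
  rewrite mulr_suml -sumrN; apply: eq_bigr => q qU.
  rewrite -mulrN -(swap q qU) mulr_sumr; apply: eq_bigl => p.
  rewrite in_setD qU -andbA; congr (_ && _) => /=.
  have [qp|] := boolP (q \in supp p); last by rewrite andbF.
  by rewrite andbT; apply/negP=> /subsetP/(_ q qp); apply/negP.
rewrite opprK -mulrDl; congr (_ * _).
rewrite /flat_weight [RHS](bigID (fun i => i \in val I)) /= addrC.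
have fl p : (row p B <= dual_span B (total_union pre))%MS = (supp p \subset U).
  by rewrite (adapted_span II ad) row_basis_span.
congr (_ + _); first by apply: eq_bigl => p; rewrite fl andbC.
rewrite (eq_bigl (fun p => (p \in val I) && ~~ (supp p \subset U))) => [|p];
  last by rewrite fl andbC.
rewrite big_mkcondr /= -big_uniq ?(independent_uniq II) //= big_tuple
  -big_mkcond /=.
by apply: eq_bigl => q; rewrite supp_tnth // sub1set.
Qed.

(** Induction on the number of positions not yet covered by [U]. Summing over
    the next block yields, by [exchange_step], the weight of the span of the
    previous blocks, and this cancels against the corresponding factor. *)
Lemma exchange_telescope M pre U L :
  chain B pre -> adapted B I pre U -> (k <= M + #|U|)%N ->
  (forall l, l \notin U -> tnth L l = tnth I l) ->
  (forall l, l \in U -> supp (tnth L l) \subset U) ->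
  sum_seqs M (exchange_summand pre L) = psi L.
Proof.
elim: M pre U L => [|M IHM] pre U L ch ad kM LI LU.
all: have [sU tU cU nc] := ad.
all: have [fullU|ltU] := eqVneq #|U| k.
- rewrite sum_seqs0 /exchange_summand cats0 elementaryE ch cU fullU eqxx /=.
  by rewrite /weights big_ord0 invr1 mul1r.
- by case/eqP: ltU; apply/eqP;
    rewrite eqn_leq kM andbT -[X in (_ <= X)%N](card_ord k) max_card.
- rewrite sum_seqs_nil => [|A r].
    rewrite /exchange_summand cats0 elementaryE ch cU fullU eqxx /=.
    by rewrite /weights big_ord0 invr1 mul1r.
  rewrite /exchange_summand; case: (boolP (elementary B _)) => //= el.
  have := total_part_extends r (extends_cat el); move: el;
    rewrite elementaryE => /andP[_ /eqP ->].
  by rewrite cU fullU ltnn.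
rewrite sum_seqsS {1}/exchange_summand cats0 elementaryE cU (negPf ltU) andbF
  add0r.
pose P p := (p \notin val I) && ~~ (supp p \subset U).
have inj : {in [set p | P p] &, injective (next_block B I U)}.
  move=> p p'; rewrite !inE => /andP[pI _] /andP[pI' _] E.
  have := next_block_out B U pI; rewrite E next_block_out // => /setP/(_ p).
  by rewrite !inE eqxx => /eqP.
rewrite (bigID (fun A => A \in next_block B I U @: [set p | P p])) /=
  [X in _ + X]big1 ?addr0 => [|A nA]; last first.
  rewrite /sum_seqs big1 // => m _; rewrite big1 // => s _.
  rewrite /exchange_summand; case: ifP => //= /andP[el /andP[/eqP A1 _]].
  have [p [pI pU AE]] := extends_only_next_block II ad (extends_cat el) A1.
  by case/negP: nA; rewrite AE imset_f // inE /P pI.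
rewrite big_imset //=.
have rkU : (\rank (dual_span B (total_union pre)) < k)%N.
  rewrite (adapted_span II ad) rank_basis_span // ltn_neqAle ltU.
  by rewrite -[X in (_ <= X)%N](card_ord k) max_card.
have wn0 := flat_weight_neq0 nc rkU.
apply: (mulfI wn0); rewrite -(exchange_step ad LI LU) mulr_sumr.
apply: eq_big => [p|p]; first by rewrite inE.
rewrite inE => /andP[pI pU]; set A := next_block B I U p.
have [exA adA] := extends_next_block II ad pI pU.
have chA := chain_rcons ch exA.
have kA : (k <= M + #|U :|: supp p|)%N.
  apply: leq_trans kM _; rewrite addSnnS leq_add2l; apply: proper_card.
  rewrite properUl //.
have E r : exchange_summand pre L (A :: r) =
  (flat_weight (total_union pre))^-1 *
    (a p * exchange_summand (rcons pre A) L r -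
     \sum_(q in supp p :\: U) a (tnth I q) * exchange_summand (rcons pre A)
       (upd L q p) r).
  rewrite /exchange_summand cat_rcons /= next_block_out // cards1 eqxx /=.
  case: ifP => _; last by rewrite mulr0 big1 ?subr0 ?mulr0 // => q _;
    rewrite mulr0.
  rewrite big_set1 weights_cons invfM -mulrA; congr (_ * _).
  rewrite mulrBr mulrCA; congr (_ - _); rewrite mulr_sumr.
  apply: eq_big => [q|q _]; first by rewrite mem_next_block.
  by rewrite mulrCA.
have -> : sum_seqs M (fun s => exchange_summand pre L (A :: s)) =
   (flat_weight (total_union pre))^-1 *
     (a p * sum_seqs M (exchange_summand (rcons pre A) L) -
     \sum_(q in supp p :\: U) a (tnth I q) * sum_seqs M
       (exchange_summand (rcons pre A) (upd L q p))).
  rewrite (eq_sum_seqs _ E) /sum_seqs !mulr_sumr.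
  under [X in _ = _ * (_ - X)]eq_bigr => q _ do rewrite mulr_sumr.
  rewrite [X in _ = _ * (_ - X)]exchange_big -sumrB mulr_sumr;
    apply: eq_bigr => m _ /=.
  rewrite mulr_sumr.
  under [X in _ = _ * (_ - X)]eq_bigr => q _ do rewrite mulr_sumr.
  rewrite [X in _ = _ * (_ - X)]exchange_big -sumrB mulr_sumr;
    apply: eq_bigr => s _ //.
rewrite mulVKf // (IHM _ _ _ chA adA kA); first last.
- move=> l; rewrite in_setU; have [lU _|lU /= lp] := boolP (l \in U).
    exact: subset_trans (LU l lU) (subsetUl _ _).
  by rewrite LI // supp_tnth // sub1set in_setU lp orbT.
- by move=> l; rewrite in_setU negb_or => /andP[lU _]; apply: LI.
congr (_ - _); apply: eq_bigr => q; rewrite in_setD => /andP[qU qp].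
rewrite (IHM _ _ _ chA adA kA) // => l; rewrite in_setU tnth_upd.
  by rewrite negb_or => /andP[lU lp]; case: eqP => [E'|_];
    [rewrite E' qp in lp|apply: LI].
case: eqP => [_ _|_]; first exact: subsetUr.
have [lU _|lU /= lp] := boolP (l \in U).
  exact: subset_trans (LU l lU) (subsetUl _ _).
by rewrite LI // supp_tnth // sub1set in_setU lp orbT.
Qed.

End Telescoping.

(** * The sum over all flags for one elementary subarrangement *)

Section ExchangeFunctional.

Variables (K : numFieldType) (n k : nat) (B : 'M[K]_(n, k)) (a : 'I_n -> K).
Variables (Js : seq {set 'I_n}) (elJ : elementary B Js).
Implicit Types (L : k.-tuple 'I_n) (A : {set 'I_n}).

Local Notation bi := (block_index Js).

Lemma transversalE L : independent B L ->
  transversal Js L = all (fun A : {set 'I_n} => #|A :\: [set j in L]| == 1%N)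
    Js.
Proof.
move=> LI; have Lu := independent_uniq LI.
have E h : (h < size Js)%N ->
    (count (fun j => bi j == h) L == part Js h) =
      (#|block Js h :\: [set j in L]| == 1%N).
  move=> hm; have -> : count (fun j => bi j == h) L =
    #|block Js h :&: [set j in L]|.
    rewrite -size_filter -(card_uniqP (filter_uniq _ Lu)); apply: eq_card => j.
    by rewrite mem_filter !inE (mem_block elJ).
  have := part_succ elJ hm; rewrite -(cardsID [set j in L] (block Js h)) => E.
  apply/eqP/eqP => E'; move: E; rewrite E'; first by rewrite -addn1 => /addnI.
  by rewrite addn1 => -[].
apply/forallP/(all_nthP set0) => [tr h hm|al h].
  by have := tr (Ordinal hm); rewrite /= E.
by rewrite E //; exact: (al h (ltn_ord h)).
Qed.

Variables (c : prepotential_choice K n k) (cJ : valid_choice B Js c).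
Variables (I : k.-tuple 'I_n) (II : independent B I) (tI : transversal Js I).
Variables (psi : k.-tuple 'I_n -> K) (psi_sing : singular B psi).
Variable (j0 : 'I_n).

Local Notation phi := (elementary_functional B Js c).
Local Notation kappa := (minors_prod B Js c ^- 2).
Local Notation same X Y := (fun A : {set 'I_n} => A :\: X == A :\: Y).

Lemma normalization L : independent B L -> transversal Js L ->
  kappa * phi L * phi L = 1.
Proof.
move=> LI tL; have [E nz] := functional_normalization elJ cJ j0 LI tL.
by rewrite -mulrA -expr2 E mulVf // expf_neq0.
Qed.

Lemma elementary_functional_neq0 L : phi L != 0 ->
  independent B L /\ transversal Js L.
Proof.
move=> nz; split; first
  by apply: contraNT nz => /elementary_functional_dependent ->.
by apply: contraNT nz; rewrite /elementary_functional => /negbTE ->;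
  rewrite mulr0 mul0r.
Qed.

(** In the sum over [j] of the values at [upd L q j], only [j = p] and
    [j = tnth L q] give transversals without repetition. *)
Lemma elementary_functional_swap L q p h : independent B L ->
  transversal Js L -> (h < size Js)%N ->
  tnth L q \in block Js h -> block Js h :\: [set j in L] = [set p] ->
  phi (upd L q p) = - phi L.
Proof.
move=> LI tL hm Lq Ep;
  have [_ phi0 /(_ L q)] := singular_elementary_functional elJ cJ.
have pA : p \in block Js h :\: [set j in L] by rewrite Ep set11.
move: pA; rewrite !inE => /andP[pL pA].
have nep : p != tnth L q by apply: contraNneq pL => ->; rewrite mem_tnth.
rewrite (bigD1 (tnth L q)) //= upd_id (bigD1 p) //= big1 ?addr0.
  by move/eqP; rewrite addrC addr_eq0 => /eqP.
move=> j /andP[nq np].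
have [jA|jA] := boolP (j \in block Js h).
  have : j \notin block Js h :\: [set j in L] by rewrite Ep inE.
  rewrite !inE jA andbT negbK => /tnthP[l El].
  apply: phi0; apply/negP=> /independent_uniq/tuple_uniqP uu.
  have : tnth (upd L q j) q = tnth (upd L q j) l.
    by rewrite !tnth_upd eqxx; case: eqP => // _; rewrite El.
  by move/uu => ql; move: nq; rewrite El ql eqxx.
apply/eqP; apply: contraNT jA => /elementary_functional_neq0[_ tj].
have := forallP tj (Ordinal hm); rewrite /= -(eqP (forallP tL (Ordinal hm))) /=.
rewrite -{2}(upd_id L q) !count_upd eqn_add2r (mem_block elJ) //.
by move: Lq; rewrite (mem_block elJ) // => ->; case: (bi j == h).
Qed.

(** Induction on [r], where [L] is [I] after the exchanges in the blocks [pre].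
    Flags with nonzero functional omit one element of the next block; sorting
    them by this element matches the terms of [exchange_sum], since an exchange
    changes the sign of the functional. When no block is left, the flag is a
    reordering of [L] and [normalization] applies. *)
Lemma exchange_functional pre r L : Js = pre ++ r ->
  independent B L -> transversal Js L ->
  (forall q, bi (tnth L q) = bi (tnth I q)) ->
  (forall q, (size pre <= bi (tnth I q))%N -> tnth L q = tnth I q) ->
  exchange_sum a I psi r L = kappa * phi L *
    \sum_(m : flag_index B | all (same [set j in val m] [set j in L]) pre)
       (\prod_(A <- r) \prod_(j in A :\: [set j in val m]) a j) *
         (phi (val m) * psi (val m)).
Proof.
elim: r pre L => [|A r IHr] pre L EJ LI tL Lb LIeq /=.
  have Epre : pre = Js by rewrite EJ cats0.
  have fp N p : phi (perm_tuple N p) * psi (perm_tuple N p) = phi N * psi N.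
    have [-> _ _] := psi_sing;
      rewrite elementary_functional_perm // mulrACA -expr2 sqrr_sign mul1r //.
  have f0 (N : k.-tuple _) : ~~ independent B N -> phi N * psi N = 0.
    by move=> dN; rewrite elementary_functional_dependent // mul0r.
  have := sum_flag_perm_eq (f := fun N => phi N * psi N) L fp f0.
  rewrite big_mkcond /= => E.
  rewrite big_mkcond /= (eq_bigr (fun m : flag_index B =>
     if perm_eq (val m) L then phi (val m) * psi (val m) else 0)) ?E.
    by rewrite mulrA normalization // mul1r.
  move=> m _; rewrite big_nil mul1r.
  have [->|/elementary_functional_neq0[mI tm]] := eqVneq (phi (val m)) 0; first
    by rewrite !mul0r !if_same.
  congr (if _ then _ else _); rewrite Epre; apply/allP/idP => [h|pm A _];
    last first.
    by apply/eqP/setP=> j; rewrite !inE (perm_mem pm).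
  apply: uniq_perm;
    [exact: independent_uniq mI|exact: independent_uniq LI|move=> j].
  have bl (N : k.-tuple 'I_n) : transversal Js N -> j \in N ->
    exists2 A, A \in Js & j \in A.
    move=> tN jN; have lt : (bi j < size Js)%N
      by apply: (transversal_lt elJ _ tN); rewrite ?size_tuple.
    exists (block Js (bi j)); first exact: mem_nth.
    by rewrite (mem_block elJ).
  apply/idP/idP => jN.
    have [A /h/eqP/setP/(_ j) + jA] := bl _ tm jN.
    by rewrite !inE jA jN !andbT => /esym/negbFE.
  have [A /h/eqP/setP/(_ j) + jA] := bl _ tL jN.
  by rewrite !inE jA jN !andbT => /negbFE.
set h := size pre.
have hm : (h < size Js)%N by rewrite EJ size_cat /= addnS ltnS leq_addr.
have AE : A = block Js h by rewrite EJ /block nth_cat ltnn subnn.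
have [p Ep] : exists p, A :\: [set j in I] = [set p].
  apply/cards1P; have := tI; rewrite transversalE // => /allP; apply.
  by rewrite EJ mem_cat inE eqxx orbT.
have AL : A :\: [set j in L] = [set p].
  rewrite -Ep; apply/setP=> j; rewrite !inE; case jA: (j \in A);
    rewrite ?andbF // !andbT.
  have bj : bi j = h by apply/eqP; rewrite -(mem_block elJ) // -AE.
  congr (~~ _); apply/tnthP/tnthP => -[q E]; exists q.
    by rewrite E LIeq // -Lb -E bj.
  by rewrite E LIeq // -E bj.
have pA : (p \in A) && (p \notin I).
  by have : p \in A :\: [set j in I] by [rewrite Ep set11]; rewrite !inE andbC.
have /andP[pAA pI] := pA.
have bp : bi p = h by apply/eqP; rewrite -(mem_block elJ) // -AE.
have EJ' : Js = rcons pre A ++ r by rewrite cat_rcons.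
pose S y := \sum_(m : flag_index B | all (same [set j in val m] [set j in L])
  pre
     && (A :\: [set j in val m] == [set y]))
   (\prod_(A <- r) \prod_(j in A :\: [set j in val m]) a j) *
     (phi (val m) * psi (val m)).
have Hp : exchange_sum a I psi r L = kappa * phi L * S p.
  rewrite (IHr (rcons pre A)) //; last by move=> q; rewrite size_rcons => /ltnW;
    apply: LIeq.
  congr (_ * _); apply: eq_bigl => m; by rewrite all_rcons andbC AL.
have Hq q : tnth I q \in A ->
    exchange_sum a I psi r (upd L q p) = - (kappa * phi L * S (tnth I q)).
  move=> IqA; have biq : bi (tnth I q) = h by apply/eqP;
    rewrite -(mem_block elJ) // -AE.
  have Lq : tnth L q = tnth I q by apply: LIeq; rewrite biq.
  have sw : phi (upd L q p) = - phi L
    by apply: (elementary_functional_swap (h := h)); rewrite -?AE ?Lq.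
  have [uI ut] : independent B (upd L q p) /\ transversal Js (upd L q p).
    apply: elementary_functional_neq0; rewrite sw oppr_eq0; apply/eqP=> E0.
    by have /eqP := normalization LI tL; rewrite E0 mulr0 eq_sym oner_eq0.
  rewrite (IHr (rcons pre A)) //.
  - rewrite sw mulrN mulNr; congr (- (_ * _)); apply: eq_bigl => m.
    rewrite all_rcons andbC; congr (_ && _).
      apply: eq_in_all => A' A'pre; congr (_ == _).
      have [h' h's A'E] : exists2 h', (h' < h)%N & A' = block Js h'.
        exists (index A' pre); first by rewrite index_mem.
        by rewrite EJ /block nth_cat index_mem A'pre nth_index.
      have hm' := ltn_trans h's hm.
      apply/setP=> j; rewrite !inE; case jA: (j \in A');
        rewrite ?andbF // !andbT.
      have bj : bi j = h' by apply/eqP; rewrite -(mem_block elJ) // -A'E.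
      congr (~~ _); apply/tnthP/tnthP => -[l].
        rewrite tnth_upd; case: eqP => [_ E|_ ->]; last by exists l.
        by move: h's; rewrite -bj E bp ltnn.
      move=> E; exists l; rewrite tnth_upd; case: eqP => [El|//].
      by move: h's; rewrite -bj E El Lb biq ltnn.
    congr (_ == _); apply/setP=> j; rewrite !inE;
      apply/andP/eqP => [[ju jA]|->].
      apply/eqP; apply: contraNT ju => nj.
      have [->|njp] := eqVneq j p; first by apply/tnthP; exists q;
        rewrite tnth_upd eqxx.
      have : j \notin A :\: [set j in L] by rewrite AL inE.
      rewrite !inE jA andbT negbK => /tnthP[l El]; apply/tnthP; exists l;
        rewrite tnth_upd.
      by case: eqP => // E; move: nj; rewrite El E Lq eqxx.
    split=> //; apply/tnthP=> -[l]; rewrite tnth_upd; case: eqP => [_ E|nl].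
      by move: pI; rewrite -E mem_tnth.
    by rewrite -Lq => /(tuple_uniqP _ (independent_uniq LI)) /esym.
  - by move=> l; rewrite tnth_upd; case: eqP => [->|_]; rewrite ?Lb // bp biq.
  move=> l; rewrite size_rcons tnth_upd; case: eqP => [->|_] hl; first
    by rewrite biq ltnn in hl.
  exact: LIeq (ltnW hl).
rewrite Ep big_set1 Hp.
have -> : \sum_(q | tnth I q \in A) a (tnth I q) * exchange_sum a I psi r
  (upd L q p) =
   - (kappa * phi L * \sum_(q | tnth I q \in A) a (tnth I q) * S (tnth I q)).
  rewrite mulr_sumr -sumrN; apply: eq_bigr => q IqA; rewrite Hq // mulrN;
    congr (- _).
  by rewrite mulrCA.
rewrite opprK mulrCA -mulrDr; congr (_ * _).
have -> : a p * S p + \sum_(q | tnth I q \in A) a (tnth I q) * S (tnth I q) =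
    \sum_(y in A) a y * S y.
  rewrite (bigID (fun y => y \in val I)) /= addrC; congr (_ + _).
    rewrite (big_pred1 p) // => y /=; have /setP/(_ y) := Ep;
      rewrite !inE => <-.
    by rewrite andbC.
  rewrite [RHS](eq_bigl (fun y => (y \in val I) && (y \in A))) => [|y];
    last by rewrite andbC.
  by rewrite [RHS]big_mkcondr /= -big_uniq ?(independent_uniq II) //= big_tuple
    -big_mkcond.
under eq_bigr => y _ do rewrite mulr_sumr.
rewrite (exchange_big_dep
  (fun m : flag_index B => all (same [set j in val m] [set j in L]) pre)) /=;
  last first.
  by move=> y m _ /andP[].
apply: eq_bigr => m allm; rewrite big_cons.
have [->|/elementary_functional_neq0[mI tm]] := eqVneq (phi (val m)) 0.
  by rewrite !(mul0r, mulr0) big1 // => y _; rewrite !(mul0r, mulr0).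
have /cards1P[x Ex] : #|A :\: [set j in val m]| == 1%N.
  by move: tm; rewrite transversalE // => /allP; apply;
    rewrite EJ mem_cat inE eqxx orbT.
rewrite Ex big_set1 (big_pred1 x) ?mulrA // => y /=;
  rewrite allm /= (inj_eq set1_inj) eq_sym.
apply/andP/eqP => [[_ /eqP]|->] //; split=> //.
by have : x \in A :\: [set j in val m];
  [rewrite Ex set11|rewrite inE => /andP[]].
Qed.

End ExchangeFunctional.

(** * The potential *)

Section Main.

Variables (K : numFieldType) (n k' : nat).
Local Notation k := k'.+1.
Variables (B : 'M[K]_(n, k)) (B_neq0 : forall j, row j B != 0).
Variables (a : 'I_n -> K) (a_neq0 : forall j, a j != 0).
Hypothesis a_unbalanced : forall x : 'I_n -> K, normal_crossings B x ->
  unbalanced B x a.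
Variable c : seq {set 'I_n} -> prepotential_choice K n k.
Hypothesis c_valid : forall Js, elementary B Js -> valid_choice B Js (c Js).
Implicit Types (I L : k.-tuple 'I_n) (Js : seq {set 'I_n}).

(** No [g_j] is zero, so the factor [a_J] is the weight attached to the zero
    span of the empty union of blocks. *)
Lemma elementary_weightE Js : elementary B Js ->
  elementary_weight B a Js = weights B a [::] Js.
Proof.
move=> el; rewrite /elementary_weight /weights /=.
have : (0 < size Js)%N.
  rewrite lt0n; apply/eqP=> E; have := part_sum_full el.
  by rewrite E /part_sum big_ord0.
case: (size Js) => // s _; rewrite big_ord_recl /= big_add1 /= big_mkord;
  congr (_ * _).
apply: eq_bigl => i; rewrite /block_union big_ord0 /dual_span big_set0 submx0.
by rewrite B_neq0.
Qed.

Lemma prod_transversal Js L : elementary B Js -> independent B L ->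
  transversal Js L ->
  \prod_(h < size Js) \prod_(j in block Js h) a j =
  (\prod_(j <- L) a j) * \prod_(A <- Js) \prod_(j in A :\: [set j in L]) a j.
Proof.
move=> el LI tL; have Lu := independent_uniq LI.
rewrite [X in _ = _ * X](big_nth set0) big_mkord /=.
have -> : \prod_(j <- L) a j =
  \prod_(h < size Js) \prod_(j in block Js h :&: [set j in L]) a j.
  rewrite big_uniq //= (exchange_big_dep (fun j => j \in val L)) /= => [|h j _];
    last first.
    by rewrite !inE => /andP[].
  apply: eq_bigr => j jL.
  have lt := transversal_lt el (size_tuple L) tL jL.
  rewrite (big_pred1 (Ordinal lt)) // => h /=;
    rewrite !inE jL andbT (mem_block el) //.
  by rewrite eq_sym.
rewrite -big_split /=; apply: eq_bigr => h _; exact: big_setID.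
Qed.

Definition elementary_gram Js I L : K :=
  (\prod_(h < size Js) \prod_(j in block Js h) a j) / minors_prod B Js (c Js) ^+
    2 *
  elementary_functional B Js (c Js) I * elementary_functional B Js (c Js) L.

Definition potential_gram I L : K :=
  sum_seqs k (fun Js => if elementary B Js then (elementary_weight B a Js)^-1 *
    elementary_gram Js I L else 0).

Lemma mderiv_potential I L :
  (minor B I * minor B L) *: iter_mderiv (I ++ L) (potential B a c) =
    (potential_gram I L)%:MP.
Proof.
rewrite /potential /potential_gram /sum_seqs iter_mderiv_sum scaler_sumr
  raddf_sum /=.
apply: eq_bigr => m _;
  rewrite big_mkcond iter_mderiv_sum scaler_sumr raddf_sum /=.
apply: eq_bigr => Js _; case: ifP => [el|_];
  last by rewrite -(scale0r 0) iter_mderivZ !scale0r scaler0 mpolyC0.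
rewrite iter_mderivZ scalerA mulrC -scalerA
  (mderiv_prepotential el (c_valid el)).
by rewrite -mul_mpolyC -mpolyCM.
Qed.

Lemma sum_seqs_lin (T : finType) (Z : finType) M (F : Z -> seq T -> K) :
  \sum_z sum_seqs M (F z) = sum_seqs M (fun s => \sum_z F z s).
Proof.
rewrite /sum_seqs exchange_big; apply: eq_bigr => m _; exact: exchange_big.
Qed.

Lemma sum_seqsZ (T : finType) M (F : seq T -> K) (x : K) :
  x * sum_seqs M F = sum_seqs M (fun s => x * F s).
Proof.
by rewrite /sum_seqs mulr_sumr; apply: eq_bigr => m _; rewrite mulr_sumr.
Qed.

Lemma sum_seqs_const0 (T : finType) M (F : seq T -> K) :
  (forall s, F s = 0) -> sum_seqs M F = 0.
Proof. by move=> F0; rewrite /sum_seqs big1 // => m _; rewrite big1. Qed.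

Lemma potential_gram_singular I : singular B (potential_gram I).
Proof.
split=> [L p|L dL|L q].
- rewrite sum_seqsZ; apply: eq_sum_seqs => Js; case: ifP => el;
    last by rewrite mulr0.
  rewrite /elementary_gram elementary_functional_perm;
    set x := _ * elementary_functional _ _ _ I; set y := (_)^-1.
  by rewrite (mulrCA x) (mulrCA y).
- apply: sum_seqs_const0 => Js; case: ifP => // el.
  by rewrite /elementary_gram (elementary_functional_dependent Js (c Js) dL)
    !mulr0.
rewrite sum_seqs_lin; apply: sum_seqs_const0 => Js;
  case: (boolP (elementary B Js)) => el; last by rewrite big1.
have [_ _ /(_ L q) E] := singular_elementary_functional el (c_valid el).
by rewrite -mulr_sumr /elementary_gram -mulr_sumr E !mulr0.
Qed.

(** The sum over flags of a fixed elementary subarrangement is an exchange sum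
    by [exchange_functional], and these add up to [psi I] by
    [exchange_telescope], starting from no block at all. *)
Lemma potential_gram_reproducing psi I : singular B psi -> independent B I ->
  psi I = \sum_(m : flag_index B) potential_gram I (val m) /
    (\prod_(j <- val m) a j) * psi (val m).
Proof.
move=> psi_sing II.
have fw X := @unbalanced_weight _ _ _ B a X a_unbalanced.
rewrite -[LHS](@exchange_telescope _ _ _ B a I II fw psi psi_sing k [::] set0
  I); first last.
- by move=> l; rewrite inE.
- by [].
- by rewrite leq_addr.
- exact: adapted_nil.
- by apply/forallP=> -[].
under eq_bigr => m _ do rewrite -mulrA mulrC sum_seqsZ.
rewrite sum_seqs_lin; apply: eq_sum_seqs => Js; rewrite /exchange_summand /=.
case: (boolP (elementary B Js)) => [el|_] /=; last by rewrite big1 // => m _;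
  rewrite mulr0.
rewrite -(transversalE el) //;
  case: (boolP (transversal Js I)) => [tI|/negbTE tI]; last first.
  rewrite big1 // => m _.
  by rewrite /elementary_gram {1}/elementary_functional tI !(mulr0, mul0r).
rewrite (@exchange_functional _ _ _ B a Js el (c Js) (c_valid el) I II tI psi
  psi_sing (tnth I ord0) [::]) //.
rewrite elementary_weightE // !mulr_sumr; apply: eq_bigr => m _;
  rewrite /elementary_gram.
set phi := elementary_functional B Js (c Js).
have [->|/elementary_functional_neq0[mI tm]] := eqVneq (phi (val m)) 0; first
  by rewrite !(mulr0, mul0r).
rewrite (prod_transversal el mI tm).
have nz : \prod_(j <- val m) a j != 0 by rewrite prodf_seq_neq0;
  apply/allP=> j _; rewrite a_neq0.
rewrite /= in nz *.
move: nz; set P := \prod_(j <- _) a j => nz.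
set Q := \prod_(A <- _) _; move: (_ ^- 2) => kap.
move: (weights _ _ _ _)^-1 => w; by field.
Qed.

End Main.

Theorem theorem6p1 (R : realType) (n k : nat) (k_gt0 : (0 < k)%N)
    (k_lt_n : (k < n)%N) (B : 'M[R[i]]_(n, k))
    (B_neq0 : forall j, row j B != 0) (B_span : row_full B)
    (a : 'I_n -> R[i]) (a_neq0 : forall j, a j != 0)
    (a_unbalanced : forall x : 'I_n -> R[i],
       normal_crossings B x -> unbalanced B x a)
    (c : seq {set 'I_n} -> prepotential_choice R[i] n k)
    (c_valid : forall Js, elementary B Js -> valid_choice B Js (c Js))
    (I L : k.-tuple 'I_n)
    (I_indep : independent B I) (L_indep : independent B L) :
  (contravariant a (sing_vector B a I) (sing_vector B a L))%:MP_[n] =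
  (minor B I * minor B L) *: iter_mderiv (I ++ L) (potential B a c).
Proof.
case: k k_gt0 k_lt_n B B_neq0 B_span a_unbalanced c c_valid I L I_indep
  L_indep => // k _ _ B B_neq0 _ a_unbalanced c c_valid I L I_indep L_indep.
rewrite (mderiv_potential _ c_valid); congr (_%:MP).
apply: projection_criterion => // [N _|psi N].
  exact: potential_gram_singular.
exact: potential_gram_reproducing.
Qed.
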